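(* For every strongly continuous one-parameter semigroup $(C_t)_{t\ge0}$ of hermitian (self-adjoint) contractions on a Hilbert space $\mathcal{H}$, there exists a euclidean realization $(U_t)_{t\in\mathbb{R}}$ on a reflection positive Hilbert space $(\mathcal{E},\mathcal{E}_+,\theta)$ for which $q:\mathcal{E}_0\to\widehat{\mathcal{E}}\cong\mathcal{H}$ is unitary and $\mathcal{E}_0$ is $U$-cyclic in $\mathcal{E}$. Any euclidean realization of $(C,\mathcal{H})$ with these two properties is equivalent to the one obtained by dilation, i.e., from the $B(\mathcal{H})$-valued positive definite function $\varphi(t):=C_{|t|}$ on $\mathbb{R}$.
   Context: A reflection positive Hilbert space is a triple $(\mathcal{E},\mathcal{E}_+,\theta)$, where $\mathcal{E}$ is a complex Hilbert space, $\theta$ is a unitary involution on $\mathcal{E}$ and $\mathcal{E}_+\subseteq\mathcal{E}$ is a closed subspace with $\langle\theta v,v\rangle\ge 0$ for all $v\in\mathcal{E}_+$. Put $\mathcal{N}=\{v\in\mathcal{E}_+:\langle\theta v,v\rangle=0\}$, let $\widehat{\mathcal{E}}$ be the Hilbert space completion of $\mathcal{E}_+/\mathcal{N}$ with respect to $\|\widehat v\|=\sqrt{\langle\theta v,v\rangle}$, let $q:\mathcal{E}_+\to\widehat{\mathcal{E}}$, $v\mapsto\widehat v$, be the canonical map, and put $\mathcal{E}_0=\{v\in\mathcal{E}_+:\theta v=v\}$. A reflection positive unitary one-parameter group on $(\mathcal{E},\mathcal{E}_+,\theta)$ is a strongly continuous unitary one-parameter group $(U_t)_{t\in\mathbb{R}}$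 with $U_t\mathcal{E}_+\subseteq\mathcal{E}_+$ for $t>0$ and $\theta U_t\theta=U_{-t}$ for $t\in\mathbb{R}$. It induces a strongly continuous semigroup $(\widehat U_t)_{t\ge0}$ of self-adjoint contractions on $\widehat{\mathcal{E}}$ with $\widehat U_t\widehat v=\widehat{U_tv}$ for $v\in\mathcal{E}_+$. The quadruple $(\mathcal{E},\mathcal{E}_+,\theta,U)$ is a euclidean realization of $(C,\mathcal{H})$ if $(\widehat U,\widehat{\mathcal{E}})$ is unitarily equivalent to $(C,\mathcal{H})$. A subspace is $U$-cyclic if its translates under all $U_t$, $t\in\mathbb{R}$, span a dense subspace. The realization obtained by dilation: the kernel $(s,t)\mapsto\varphi(s-t)$ on $\mathbb{R}$ is $B(\mathcal{H})$-valued positive definite; $\mathcal{E}_\varphi\subseteq C(\mathbb{R},\mathcal{H})$ is the corresponding reproducing kernel Hilbert space, i.e. the unique Hilbert space of functions $\mathbb{R}\to\mathcal{H}$ with continuous point evaluations $\mathrm{ev}_s$ satisfying $\mathrm{ev}_s\mathrm{ev}_t^*=\varphi(s-t)$. On it, $(U_tf)(s)=f(s+t)$, $(\theta f)(s)=f(-s)$, and $\mathcal{E}_{\varphi,+}$ is the closed subspace generated by the functions $s\mapsto\varphi(s+t)v$, $t>0$, $v\in\mathcal{H}$. Two euclidean realizations are equivalent if there is a unitary isomorphism of the underlying Hilbert spaces intertwining the one-parameter groups and the involutions and mapping the one $\theta$-positive subspace onto the other. *)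

(* Defs.v *)
From HB Require Import structures.
From mathcomp Require Import all_boot all_order all_algebra sesquilinear.
From mathcomp Require Import complex.
From mathcomp Require Import all_classical all_reals all_analysis.

Set Implicit Arguments.
Unset Strict Implicit.
Unset Printing Implicit Defensive.

Import Order.TTheory GRing.Theory Num.Theory.
Import numFieldNormedType.Exports.

Local Open Scope classical_set_scope.
Local Open Scope ring_scope.

(* The form is linear in its first argument and conjugate-linear in its second.
   As in [normedModType], the norm takes its values in R[i]. *)
HB.mixin Record CompleteNormedModule_isHilbert (R : realType) V
    & CompleteNormedModule R[i] V := {
  hdot : {dot V for @Num.conj R[i]};
  hdotE : forall v : V, hdot v v = `|v| ^+ 2
}.

#[short(type="hilbertType")]
HB.structure Definition Hilbert (R : realType) :=
  {V of CompleteNormedModule R[i] V & CompleteNormedModule_isHilbert R V}.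

Notation "''[' u , v ]" := (hdot u v) (format "''[' u ,  v ]") : ring_scope.

Section HilbertSpaces.
Variable R : realType.

Definition linear_subspace (V : hilbertType R) (A : set V) : Prop :=
  GRing.submod_closed (mem A).

Definition lspan (V : hilbertType R) (A : set V) : set V :=
  smallest (@linear_subspace V) A.

Definition unitary (V W : hilbertType R) (f : {linear V -> W}) : Prop :=
  isometry hdot hdot f /\ bijective f.

Definition adjoint (V W : hilbertType R)
    (f : {linear V -> W}) (g : {linear W -> V}) : Prop :=
  forall v w, '[f v, w] = '[v, g w].

(* Only the values C t with 0 <= t are relevant. *)
Record selfadjoint_contraction_semigroup (H : hilbertType R)
    (C : R -> {linear H -> H}) : Prop := {
  semigroup0 : forall v, C 0 v = v;
  semigroupD : forall s t : R, 0 <= s -> 0 <= t ->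
    forall v, C (s + t) v = C s (C t v);
  semigroup_selfadjoint : forall t : R, 0 <= t -> adjoint (C t) (C t);
  semigroup_contraction : forall t : R, 0 <= t -> forall v, `|C t v| <= `|v|;
  semigroup_continuous : forall v,
    {within `[0, +oo[, continuous (fun t : R => C t v)}
}.

Record unitary_group (E : hilbertType R) (U : R -> {linear E -> E}) : Prop := {
  group_unitary : forall t, unitary (U t);
  group0 : forall v, U 0 v = v;
  groupD : forall s t v, U (s + t) v = U s (U t v);
  group_continuous : forall v, continuous (fun t : R => U t v)
}.

Record rpHilbert := RPHilbert {
  rp_space :> hilbertType R;
  rp_pos : set rp_space;
  rp_theta : {linear rp_space -> rp_space};
  rp_theta_unitary : unitary rp_theta;
  rp_theta_involutive : involutive rp_theta;
  rp_pos_closed : closed rp_pos;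
  rp_pos_subspace : linear_subspace rp_pos;
  rp_pos_ge0 : forall v, rp_pos v -> 0 <= '[rp_theta v, v]
}.

Arguments rp_pos : clear implicits.
Arguments rp_theta : clear implicits.

Definition rp_fixed (X : rpHilbert) : set X :=
  [set v | rp_pos X v /\ rp_theta X v = v].

Arguments rp_fixed : clear implicits.

Record rp_unitary_group (X : rpHilbert) (U : R -> {linear X -> X}) : Prop := {
  rp_group_unitary : unitary_group U;
  rp_group_pos : forall t : R, 0 < t -> U t @` rp_pos X `<=` rp_pos X;
  rp_group_theta : forall t v, rp_theta X (U t (rp_theta X v)) = U (- t) v
}.

(* (Y, q) is the Hilbert space completion of E_+ / N: since the norm of q v is
   sqrt <theta v, v>, the kernel of q on E_+ is N, and q induces an isometric
   linear map from E_+ / N onto a dense subspace of Y. The values of q outside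
   E_+ are irrelevant. *)
Record rp_completion (X : rpHilbert) (Y : hilbertType R) (q : X -> Y) : Prop := {
  rp_completion_linear : forall a v w, rp_pos X v -> rp_pos X w ->
    q (a *: v + w) = a *: q v + q w;
  rp_completion_norm : forall v, rp_pos X v ->
    `|q v| = sqrtC '[rp_theta X v, v];
  rp_completion_dense : dense (q @` rp_pos X)
}.

Definition induced_semigroup (X : rpHilbert) (U : R -> {linear X -> X})
    (Y : hilbertType R) (q : X -> Y) (S : R -> {linear Y -> Y}) : Prop :=
  selfadjoint_contraction_semigroup S /\
  forall (t : R) v, 0 <= t -> rp_pos X v -> S t (q v) = q (U t v).

Definition semigroup_equiv (Y H : hilbertType R)
    (S : R -> {linear Y -> Y}) (C : R -> {linear H -> H}) : Prop :=
  exists W : {linear Y -> H}, unitary W /\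
    forall (t : R) v, 0 <= t -> W (S t v) = C t (W v).

Definition euclidean_realization (H : hilbertType R) (C : R -> {linear H -> H})
    (X : rpHilbert) (U : R -> {linear X -> X})
    (Y : hilbertType R) (q : X -> Y) : Prop :=
  [/\ rp_unitary_group U, rp_completion q &
      exists2 S : R -> {linear Y -> Y},
        induced_semigroup U q S & semigroup_equiv S C].

Definition unitary_on_fixed (X : rpHilbert) (Y : hilbertType R)
    (q : X -> Y) : Prop :=
  {in rp_fixed X &, forall v w, '[q v, q w] = '[v, w]} /\
  set_bij (rp_fixed X) setT q.

Definition cyclic_for (E : hilbertType R) (U : R -> {linear E -> E})
    (A : set E) : Prop :=
  dense (lspan (\bigcup_t (U t @` A))).

Definition realization_equiv (X X' : rpHilbert)
    (U : R -> {linear X -> X}) (U' : R -> {linear X' -> X'}) : Prop :=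
  exists W : {linear X -> X'},
    [/\ unitary W,
        forall t v, W (U t v) = U' t (W v),
        forall v, W (rp_theta X v) = rp_theta X' (W v) &
        W @` rp_pos X = rp_pos X'].

(* The first clause says that the values of K are bounded operators. *)
Definition pos_def_kernel (H : hilbertType R) (T : Type)
    (K : T -> T -> {linear H -> H}) : Prop :=
  (forall s t, continuous (K s t)) /\
  forall n (s : 'I_n -> T) (v : 'I_n -> H),
    0 <= \sum_(j < n) \sum_(k < n) '[K (s j) (s k) (v k), v j].

(* A Hilbert space of functions T -> H is given as a Hilbert space F with
   jointly injective linear point evaluations: f stands for the function
   s |-> ev s f. *)
Record is_rkhs (H : hilbertType R) (T : Type) (K : T -> T -> {linear H -> H})
    (F : hilbertType R) (ev : T -> {linear F -> H}) : Prop := {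
  rkhs_inj : forall f g, (forall s, ev s f = ev s g) -> f = g;
  rkhs_continuous : forall s, continuous (ev s);
  rkhs_kernel : exists2 ev_adj : T -> {linear H -> F},
    forall t, adjoint (ev t) (ev_adj t) &
    forall s t v, ev s (ev_adj t v) = K s t v
}.

Record dilation (H : hilbertType R) (phi : R -> {linear H -> H})
    (X : rpHilbert) (U : R -> {linear X -> X})
    (ev : R -> {linear X -> H}) : Prop := {
  dilation_rkhs : is_rkhs (fun s t => phi (s - t)) ev;
  dilation_continuous : forall f, continuous (fun s : R => ev s f);
  dilation_group : forall t f s, ev s (U t f) = ev (s + t) f;
  dilation_theta : forall f s, ev s (rp_theta X f) = ev (- s) f;
  dilation_pos : rp_pos X = closure (lspan [set f : X |
    exists (t : R) v, 0 < t /\ forall s, ev s f = phi (s + t) v])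
}.

End HilbertSpaces.

Arguments rp_pos {R} _ _.
Arguments rp_theta {R} _.
Arguments rp_fixed {R} X _.

(* Main.v *)
Require Import Defs.
From HB Require Import structures.
From mathcomp Require Import all_boot all_order all_algebra sesquilinear.
From mathcomp Require Import complex.
From mathcomp Require Import all_classical all_reals all_analysis.
From mathcomp Require Import ring lra.

Set Implicit Arguments.
Unset Strict Implicit.
Unset Printing Implicit Defensive.

Import Order.TTheory GRing.Theory Num.Theory.
Import numFieldNormedType.Exports.

Local Open Scope classical_set_scope.
Local Open Scope ring_scope.

(** The dilation.  The kernel C_|s-t| is positive definite: for points in
    increasing order, the quadratic form dominates the squared norm of the vector
    sum_k C_(s_k - s_0) v_k, because prefixing a point on the left changes the two
    sides by amounts that compare by contractivity ([Cform_ge]).  The theorem of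
    Moore and Aronszajn ([rkhs_exists]) then gives a Hilbert space F of functions
    with point evaluations ev_s, whose kernel functions k_t v = ev_t^* v are total.
    Translation and reflection of the real line preserve the kernel, so they permute
    the kernel functions without changing their Gram matrix and extend to unitaries
    ([kernel_symmetry]); strong continuity is inherited from the semigroup.  The
    positive subspace P is the closed span of the k_(-t) v with t > 0.

    The realization.  On P evaluation at zero does everything: comparing on kernel
    functions gives ev_t f = C_t (ev_0 f) for t >= 0 ([ev_pos_space]) and
    <theta f, g> = <ev_0 f, ev_0 g> ([reflection_form]).  Thus ev_0 : P -> H is the
    completion map, it carries the translations to the semigroup, and it is unitary
    on the fixed vectors k_0 v, whose translates k_t v span F.

    Uniqueness.  In any realization let j v be the fixed vector that corresponds to
    v in H.  Since theta (j w) = j w, the correlations <U_r (j v), j w> with r >= 0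
    are inner products in the completion, namely <C_r v, w> ([fixed_correlation]).
    Hence the vectors U_(-t) (j v) have the same Gram matrix as the k_t v, and both
    families are total, so a unitary carries one to the other ([gram_unitary]); it
    intertwines the groups and the involutions.  It also matches the positive
    subspaces, because the one of the given realization is the closed span of the
    future U_t (j v), t > 0, of the fixed vectors ([pos_closed_span]): a vector of it
    that is orthogonal to this future is orthogonal to the fixed vectors, so q kills
    it, so it is orthogonal to the reflected future as well, and it vanishes by
    cyclicity.

    The Hilbert space theory behind this consists of the orthogonal projection
    ([projection]) and the two constructions quoted above.  Limits are produced by a
    form of Cantor's intersection theorem ([nested_complete]) rather than by
    sequences. *)

Local Notation "x %:C" := (real_complex _ x) (format "x %:C") : ring_scope.

(** * Inner products *)

Section Forms.
Variable R : realType.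

(** The discriminant argument behind the Cauchy-Schwarz inequality.  A vanishing c
    is allowed because the lemma also serves for forms that are only semidefinite. *)
Lemma discriminant_le (a b c : R[i]) : 0 <= c ->
  (forall z, 0 <= a + (z^* * b + z * b^*) + z * z^* * c) -> `|b| ^+ 2 <= a * c.
Proof.
move=> c0 h; have [c_eq0|cN0] := eqVneq c 0.
  have [->|bN0] := eqVneq b 0; first by rewrite c_eq0 normr0 expr0n mulr0.
  have a0 : 0 <= a by have := h 0; rewrite conjC0 !mul0r !addr0.
  have b2 : 0 < `|b| ^+ 2 by rewrite exprn_gt0// normr_gt0.
  set t := (a + 1) / `|b| ^+ 2.
  have tr : t^* = t.
    apply/CrealP/ger0_real/divr_ge0; [exact: addr_ge0|exact: ltW].
  have := h (- t * b).
  rewrite !rmorphM !rmorphN /= tr c_eq0 mulr0 addr0.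
  have -> : - t * b^* * b + - t * b * b^* = - (t * `|b| ^+ 2) *+ 2.
    by rewrite normCK; ring.
  rewrite /t divfK ?gt_eqF// => a1.
  have : 0 <= - (a + 2).
    by apply: le_trans a1 _; rewrite le_eqVlt; apply/orP; left; apply/eqP; ring.
  rewrite oppr_ge0 => a2; have : 0 < a + 2 by apply: ltr_wpDl.
  by move=> /lt_le_trans/(_ a2); rewrite ltxx.
have {c0 cN0} c0 : 0 < c by rewrite lt_def cN0.
have cr : c^* = c by apply/CrealP/ger0_real/ltW.
have := h (- b / c).
rewrite !rmorphM fmorphV !rmorphN /= cr.
have -> : a + (- b^* / c * b + - b / c * b^*) + - b / c * (- b^* / c) * c =
    a - `|b| ^+ 2 / c.
  by rewrite normCK; field; rewrite gt_eqF.
by rewrite subr_ge0 ler_pdivrMr.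
Qed.

End Forms.

Section Hilbert.
Variables (R : realType) (V : hilbertType R).
Implicit Types (u v w : V) (z : R[i]).

Lemma hdotC u v : '[u, v] = '[v, u]^*.
Proof. by rewrite [LHS]hermC expr0 mul1r. Qed.

Lemma hdotDl u v w : '[u + v, w] = '[u, w] + '[v, w].
Proof. exact: linearDl. Qed.

Lemma hdotDr u v w : '[u, v + w] = '[u, v] + '[u, w].
Proof. exact: linearDr. Qed.

Lemma hdotBl u v w : '[u - v, w] = '[u, w] - '[v, w].
Proof. exact: linearBl. Qed.

Lemma hdotBr u v w : '[u, v - w] = '[u, v] - '[u, w].
Proof. exact: linearBr. Qed.

Lemma hdotZl z u v : '[z *: u, v] = z * '[u, v].
Proof. exact: linearZl_LR. Qed.

Lemma hdotZr z u v : '[u, z *: v] = z^* * '[u, v].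
Proof. exact: linearZr_LR. Qed.

Lemma hdot0l v : '[0, v] = 0.
Proof. exact: linear0l. Qed.

Lemma hdot_suml I (r : seq I) (P : pred I) (F : I -> V) v :
  '[\sum_(i <- r | P i) F i, v] = \sum_(i <- r | P i) '[F i, v].
Proof. exact: linear_sumlz. Qed.

Lemma hdot_sumr I (r : seq I) (P : pred I) (F : I -> V) v :
  '[v, \sum_(i <- r | P i) F i] = \sum_(i <- r | P i) '[v, F i].
Proof. exact: linear_sumr. Qed.

Lemma hdot_eq0 v : '[v, v] = 0 -> v = 0.
Proof. by rewrite hdotE => /eqP; rewrite sqrf_eq0 normr_eq0 => /eqP. Qed.

Lemma hdot_injr u v : (forall w, '[w, u] = '[w, v]) -> u = v.
Proof.
by move=> uv; apply/subr0_eq/hdot_eq0; rewrite hdotBr uv subrr.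
Qed.

Lemma hdot_injl u v : (forall w, '[u, w] = '[v, w]) -> u = v.
Proof. by move=> uv; apply/hdot_injr => w; rewrite hdotC uv -hdotC. Qed.

Lemma hdot_le u v : `|'[u, v]| <= `|u| * `|v|.
Proof.
rewrite -(ler_pXn2r (ltn0Sn 1)) ?nnegrE ?mulr_ge0// exprMn -!hdotE.
apply: discriminant_le => [|z]; first by rewrite hdotE exprn_ge0.
have : 0 <= '[u + z *: v, u + z *: v] by rewrite hdotE exprn_ge0.
rewrite hdotDl !hdotDr !hdotZl !hdotZr -(hdotC v u).
by congr (0 <= _); ring.
Qed.

End Hilbert.

(** * Completeness *)

Section Completeness.
Variables (K : numFieldType) (V : completeNormedModType K).

Lemma le_total_pos (e e' : K) : 0 < e -> 0 < e' -> e <= e' \/ e' <= e.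
Proof. by move=> e0 e'0; apply/orP/real_comparable; exact: gtr0_real. Qed.

Lemma exists_le_pos (e e' : K) : 0 < e -> 0 < e' ->
  exists x : K, [/\ 0 < x, x <= e & x <= e'].
Proof.
by move=> e0 e'0; have [h|h] := le_total_pos e0 e'0; [exists e|exists e'].
Qed.

(** Cantor's intersection theorem: the sets P e generate a Cauchy filter, and l is
    its limit.  Indexing the sets by a precision e makes it possible to define limits
    of approximations without choosing a sequence of them. *)
Lemma nested_complete (P : K -> V -> Prop) :
  (forall e : K, 0 < e -> exists v, P e v) ->
  (forall (e e' : K) v, e <= e' -> P e v -> P e' v) ->
  (forall d : K, 0 < d -> exists2 e : K, 0 < e &
    forall v w, P e v -> P e w -> `|v - w| <= d) ->
  exists l, forall d : K, 0 < d ->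
    exists e : K, [/\ 0 < e, e <= d & forall v, P e v -> `|l - v| <= d].
Proof.
move=> Pne Pmono Pdiam.
pose F := filter_from [set e : K | 0 < e] (fun e => [set v | P e v]).
have FF : Filter F.
  apply: filter_from_filter; first by exists 1; exact: ltr01.
  move=> e e' e0 e'0; have [ee'|e'e] := le_total_pos e0 e'0.
  - by exists e => // v Pv; split => //; exact: Pmono Pv.
  - by exists e' => // v Pv; split => //; exact: Pmono Pv.
have PF : ProperFilter F.
  by apply: filter_from_proper => // e e0; have [v] := Pne e e0; exists v.
have cF : cauchy F.
  apply/cauchy_ballP => d d0.
  have d2 : 0 < d / 2 by rewrite divr_gt0.
  have [e e0 He] := Pdiam _ d2.
  exists ([set v | P e v], [set v | P e v]); first by split; exists e.
  move=> [v w] [/= Pv Pw]; rewrite -ball_normE /ball_ /=.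
  apply: le_lt_trans (He _ _ Pv Pw) _.
  by rewrite ltr_pdivrMr// ltr_pMr// ltr1n.
have /fcvgrPdist_lt Fl : F --> lim F by exact: cauchy_cvg.
exists (lim F) => d d0; have [e e0 He] := Fl d d0.
have [ed|de] := le_total_pos e0 d0; first by exists e; split=> // v /He /ltW.
by exists d; split=> // v Pv; apply/ltW/He; exact: Pmono Pv.
Qed.

End Completeness.

(** * Closed subspaces *)

Section Subspaces.
Variable R : realType.

Lemma closureP (V : hilbertType R) (A : set V) x :
  closure A x <-> forall e : R[i], 0 < e -> exists2 a, A a & `|x - a| < e.
Proof.
split=> [cA e e0|cA B /nbhs_ballP[e /= e0 eB]].
  have [a [Aa]] := cA _ (nbhsx_ballx x e e0).
  by rewrite -ball_normE; exists a.
by have [a Aa xa] := cA e e0; exists a; split => //; apply: eB; rewrite -ball_normE.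
Qed.

Lemma lipschitz_continuous (V W : hilbertType R) (f : {linear V -> W}) (M : R[i]) :
  0 <= M -> (forall v, `|f v| <= M * `|v|) -> continuous f.
Proof.
move=> M0 hf v; apply/cvgrPdist_le => e e0.
have M1 : 0 < M + 1 by rewrite ltr_wpDl.
near=> w; rewrite -linearB.
apply: le_trans (hf _) _; apply: le_trans (_ : (M + 1) * `|v - w| <= _).
  by rewrite ler_wpM2r// lerDl.
rewrite -ler_pdivlMl//; apply/ltW; near: w.
by apply: cvgr_dist_lt => //; rewrite mulr_gt0// invr_gt0.
Unshelve. all: by end_near. Qed.

Lemma linear_subspaceP (V : hilbertType R) (A : set V) : linear_subspace A <->
  A 0 /\ forall a u v, A u -> A v -> A (a *: u + v).
Proof.
split=> [[A0 AD]|[A0 AD]]; split.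
- by move: A0; rewrite inE.
- by move=> a u v Au Av; have := AD a u v; rewrite !inE; apply.
- by rewrite inE.
- by move=> a u v; rewrite !inE; exact: AD.
Qed.

Definition closed_subspace (V : hilbertType R) (A : set V) :=
  linear_subspace A /\ closed A.

Section OneSpace.
Variable V : hilbertType R.
Implicit Types (A B : set V).

Lemma subspace0 A : linear_subspace A -> A 0.
Proof. by case/linear_subspaceP. Qed.

Lemma subspaceP A a u v : linear_subspace A -> A u -> A v -> A (a *: u + v).
Proof. by case/linear_subspaceP => _; exact. Qed.

Lemma subspaceZ A a u : linear_subspace A -> A u -> A (a *: u).
Proof.
by move=> sA Au; rewrite -[_ *: _]addr0; apply: subspaceP => //; exact: subspace0.
Qed.

Lemma subspaceD A u v : linear_subspace A -> A u -> A v -> A (u + v).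
Proof. by move=> sA Au; rewrite -[u]scale1r; exact: subspaceP. Qed.

Lemma subspaceB A u v : linear_subspace A -> A u -> A v -> A (u - v).
Proof.
by move=> sA Au Av; rewrite -scaleN1r addrC; exact: subspaceP.
Qed.

Lemma subspace_lspan A : linear_subspace (lspan A).
Proof.
apply/linear_subspaceP; split=> [B [sB _]|a u v Au Av B sAB].
  exact: subspace0.
have [sB _] := sAB.
by apply: subspaceP sB _ _; [exact: Au|exact: Av].
Qed.

Lemma sub_lspan A : A `<=` lspan A.
Proof. by move=> v Av B [_]; apply. Qed.

Lemma lspan_min A B : linear_subspace B -> A `<=` B -> lspan A `<=` B.
Proof. by move=> sB AB v; apply. Qed.

Lemma subspace_closure A : linear_subspace A -> linear_subspace (closure A).
Proof.
move=> sA; apply/linear_subspaceP; split.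
  by apply: subset_closure; exact: subspace0.
move=> a u v /closureP cu /closureP cv; apply/closureP => e e0.
have e2 : 0 < e / 2 by rewrite divr_gt0.
have a1 : 0 < `|a| + 1 by rewrite ltr_wpDl.
have [u' Au uu'] := cu (e / 2 / (`|a| + 1)) (divr_gt0 e2 a1).
have [v' Av vv'] := cv _ e2.
exists (a *: u' + v'); first exact: subspaceP.
rewrite (_ : _ - _ = a *: (u - u') + (v - v')); last first.
  by rewrite scalerBr opprD addrACA.
apply: le_lt_trans (ler_normD _ _) _.
rewrite [e]splitr ler_ltD// normrZ.
rewrite ltr_pdivlMr// in uu'.
apply: le_trans (ltW uu'); rewrite mulrC ler_wpM2l//.
by rewrite lerDl.
Qed.

Lemma closed_subspace_span A : closed_subspace (closure (lspan A)).
Proof.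
by split; [exact/subspace_closure/subspace_lspan|exact: closed_closure].
Qed.

Lemma sub_closed_span A : A `<=` closure (lspan A).
Proof. by move=> v Av; apply: subset_closure; exact: sub_lspan. Qed.

Lemma closed_span_min A B : closed_subspace B -> A `<=` B ->
  closure (lspan A) `<=` B.
Proof.
move=> [sB cB] AB v cv; rewrite (closure_id B).1//.
by apply: closureS cv; exact: lspan_min.
Qed.

Lemma closed_subspace_orth w : closed_subspace [set v : V | '[v, w] = 0].
Proof.
split; first apply/linear_subspaceP; first split => /=.
- exact: hdot0l.
- by move=> a u v uw vw; rewrite hdotDl hdotZl uw vw mulr0 addr0.
move=> v /closureP cv /=; apply/eqP; rewrite -normr_eq0; apply/eqP/le_anti.
rewrite normr_ge0 andbT; apply/ler_addgt0Pl => e e0; rewrite addr0.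
have w1 : 0 < `|w| + 1 by rewrite ltr_wpDl.
have [u /= uw vu] := cv (e / (`|w| + 1)) (divr_gt0 e0 w1).
rewrite -[X in `|X|]subr0 -uw -hdotBl; apply: le_trans (hdot_le _ _) _.
rewrite ltr_pdivlMr// in vu; apply: le_trans (ltW vu).
by rewrite ler_wpM2l// lerDl.
Qed.

Lemma dense_closed_span A :
  dense (lspan A) <-> (forall v, closure (lspan A) v).
Proof.
split=> [dA v B|cA B [v Bv] oB].
  rewrite nbhsE => -[B' [oB' vB'] BB'].
  have [w [vw Aw]] := dA _ (ex_intro _ v vB') oB'.
  by exists w; split => //; exact: BB'.
by have [w [Aw Bw]] := cA v _ (open_nbhs_nbhs (conj oB Bv)); exists w.
Qed.

End OneSpace.

Section TwoSpaces.
Variables (V W : hilbertType R).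

Lemma closed_subspace_preimage (f : {linear V -> W}) (B : set W) :
  continuous f -> closed_subspace B -> closed_subspace (f @^-1` B).
Proof.
move=> cf [sB cB]; split; last by apply: preimage_closed => // x _; exact: cf.
apply/linear_subspaceP; split=> /=; first by rewrite linear0; exact: subspace0.
by move=> a u v fu fv; rewrite /= linearP; exact: subspaceP.
Qed.

Lemma closed_subspace_eq (f g : {linear V -> W}) :
  continuous f -> continuous g -> closed_subspace [set v : V | f v = g v].
Proof.
move=> cf cg; have cfg : continuous (f \- g).
  by move=> v; apply: cvgB; [exact: cf|exact: cg].
have := @closed_subspace_preimage (f \- g) _ cfg _.
have s0 : @closed_subspace W [set 0].
  split; last by exact/accessible_closed_set1/hausdorff_accessible/norm_hausdorff.
  by apply/linear_subspaceP; split=> //= a _ _ -> ->; rewrite scaler0 addr0.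
move=> /(_ _ s0); rewrite (_ : _ @^-1` _ = [set v | f v = g v])//.
by apply/seteqP; split=> v /=; [move/subr0_eq|move=> ->; rewrite subrr].
Qed.

End TwoSpaces.

End Subspaces.

(** * Orthogonal projection *)

Section Projection.
Variables (R : realType) (V : hilbertType R).
Implicit Types (u v w : V).

Lemma gt0_real_complex (e : R[i]) : 0 < e -> exists2 r : R, 0 < r & e = r%:C.
Proof.
move=> e0; have /complex_realP[r er] : e \is Num.real by exact: gtr0_real.
by exists r => //; rewrite -ltcR -er.
Qed.

Lemma hdot_parallelogram u v :
  `|u - v| ^+ 2 = `|u| ^+ 2 *+ 2 + `|v| ^+ 2 *+ 2 - `|u + v| ^+ 2.
Proof.
by rewrite -!hdotE hdotBl hdotDl !hdotBr !hdotDr; ring.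
Qed.

(** First variation: moving from the point nearest to the origin along y does
    not decrease the norm, so the linear term in the displacement vanishes. *)
Lemma nearest_orthogonal u y :
  (forall z : R[i], `|u| <= `|u + z *: y|) -> '[u, y] = 0.
Proof.
move=> h; apply/eqP; rewrite -normr_eq0 -sqrf_eq0; apply/eqP/le_anti.
rewrite exprn_ge0// andbT -[leRHS](mul0r '[y, y]).
apply: discriminant_le => [|z]; first by rewrite hdotE exprn_ge0.
have : `|u| ^+ 2 <= `|u + z *: y| ^+ 2 by rewrite ler_pXn2r ?nnegrE.
rewrite -subr_ge0 -!hdotE hdotDl !hdotDr !hdotZl !hdotZr -(hdotC y u).
by congr (0 <= _); ring.
Qed.

(** By the parallelogram identity, points of M that are almost nearest to x are close
    to one another, so they converge to a nearest point. *)
Theorem projection (M : set V) x : closed_subspace M ->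
  exists2 m, M m & forall y, M y -> '[x - m, y] = 0.
Proof.
move=> [sM cM].
have [hn hnE] : exists hn : V -> R, forall v, `|v| = (hn v)%:C.
  by exists (fun v => complex.Re `|v|) => v; rewrite RRe_real// ger0_real.
have hn0 u : 0 <= hn u by rewrite -lecR -hnE normr_ge0.
pose D := [set hn (x - m) | m in M].
have hD : has_inf D.
  split; first by exists (hn (x - 0)); exists 0 => //; exact: subspace0.
  by exists 0 => _ [m _ <-].
set d := inf D.
have d0 : 0 <= d by apply: lb_le_inf; [case: hD|move=> _ [m _ <-]].
have dM m : M m -> d <= hn (x - m) by move=> Mm; apply: ge_inf; [case: hD|exists m].
pose P (e : R[i]) v := M v /\ `|x - v| <= d%:C + e.
have [|||l Hl] := @nested_complete _ _ P.
- move=> e /gt0_real_complex[r r0 ->].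
  have [_ [m Mm <-] mr] := inf_adherent r0 hD.
  by exists m; split=> //; rewrite hnE -rmorphD lecR ltW.
- by move=> e e' v ee' [Mv Hv]; split=> //; apply: le_trans Hv _; rewrite lerD2l.
(* Two points at distance at most d + e from x are, squared, at most
   4 (d + e)^2 - 4 d^2 = 8 d e + 4 e^2 apart, which for e <= 1 is at most
   e (8 d + 4). *)
- move=> c /gt0_real_complex[r r0 ->].
  have d1 : 0 < 8 * d + 4 by lra.
  pose e := Num.min 1 (r ^+ 2 / (8 * d + 4)).
  have e0 : 0 < e by rewrite lt_min ltr01 divr_gt0 ?exprn_gt0.
  have e1 : e <= 1 by rewrite ge_min lexx.
  have er : e * (8 * d + 4) <= r ^+ 2.
    by rewrite -ler_pdivlMr// ge_min lexx orbT.
  exists e%:C; first by rewrite ltcR.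
  move=> v w [Mv Hv] [Mw Hw].
  have := hdot_parallelogram (x - w) (x - v).
  rewrite (_ : x - w - (x - v) = v - w); last by rewrite opprB addrC addrA subrK.
  have [m Mm ->] : exists2 m, M m & x - w + (x - v) = 2 *: (x - m).
    exists (2^-1 *: (v + w)); first exact: subspaceZ _ sM (subspaceD sM Mv Mw).
    rewrite scalerBr scalerA divff// scale1r scaler_nat mulr2n.
    by rewrite opprD addrACA [- w - v]addrC.
  move: Hv Hw; rewrite normrZ normr_nat !hnE -rmorphD !lecR => Hv Hw.
  rewrite -(rmorph_nat (real_complex R)) -rmorphM -!rmorphXn -!rmorphMn.
  rewrite -!rmorphD -rmorphB => /complexI Hp.
  rewrite -(ler_pXn2r (ltn0Sn 1)) ?nnegrE// ?(ltW r0)//.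
  have de0 : 0 <= d + e by rewrite addr_ge0// ltW.
  have Hv2 : hn (x - v) ^+ 2 <= (d + e) ^+ 2 by rewrite ler_pXn2r ?nnegrE.
  have Hw2 : hn (x - w) ^+ 2 <= (d + e) ^+ 2 by rewrite ler_pXn2r ?nnegrE.
  have Hd2 : d ^+ 2 <= hn (x - m) ^+ 2 by rewrite ler_pXn2r ?nnegrE// dM.
  rewrite Hp; apply: le_trans er.
  have ee : e ^+ 2 <= e by rewrite expr2 ger_pMr.
  by rewrite exprMn; nra.
have near_l (r : R) : 0 < r ->
    exists m, [/\ M m, `|x - m| <= d%:C + r%:C & `|l - m| <= r%:C].
  move=> r0; have rC : 0 < r%:C by rewrite ltcR.
  have [_ [/gt0_real_complex[s s0 ->] sr Hs]] := Hl _ rC.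
  have [_ [m Mm <-] mr] := inf_adherent s0 hD.
  have Pm : P s%:C m by split=> //; rewrite hnE -rmorphD lecR ltW.
  exists m; split; [by []| |exact: Hs].
  by apply: le_trans Pm.2 _; rewrite lerD2l.
have Ml : M l.
  rewrite (closure_id M).1//; apply/closureP => e /gt0_real_complex[r r0 ->].
  have [m [Mm _ lm]] := near_l (r / 2) (divr_gt0 r0 (ltr0n _ 2)).
  by exists m => //; apply: le_lt_trans lm _; rewrite ltcR; lra.
exists l => // y My; apply: nearest_orthogonal => z.
have -> : x - l + z *: y = x - (l - z *: y) by rewrite opprB addrA addrAC.
apply: (@le_trans _ _ d%:C); last first.
  by rewrite hnE lecR; apply: dM; exact: subspaceB (subspaceZ _ sM My).
apply/ler_addgt0Pl => e /gt0_real_complex[r r0 ->].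
have [m [Mm xm lm]] := near_l (r / 2) (divr_gt0 r0 (ltr0n _ 2)).
rewrite -[x - l](subrKA m); apply: le_trans (ler_normD _ _) _.
apply: le_trans (lerD xm _) _; first by rewrite distrC; exact: lm.
by rewrite -!rmorphD lecR; lra.
Qed.

(** The projection of x onto M differs from x by a vector orthogonal to M. *)
Corollary orthogonal_total (M : set V) : closed_subspace M ->
  (forall x, (forall y, M y -> '[x, y] = 0) -> x = 0) -> forall x, M x.
Proof.
move=> sM M0 x; have [m Mm xm] := projection x sM.
by rewrite (subr0_eq (M0 _ xm)).
Qed.

End Projection.

(** * Isometries and Gram matrices *)

Section Isometries.
Variable R : realType.

Lemma linear_bundle (V W : lmodType R[i]) (f : V -> W) : linear f ->
  exists F : {linear V -> W}, forall v, F v = f v.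
Proof.
move=> lf; pose m := GRing.isLinear.Build _ _ _ _ f lf.
by pose F : {linear V -> W} := HB.pack f m; exists F.
Qed.

(** The vectors u + v and i u + v give two equations for B u v and B v u.  The domain
    is a subset because the canonical map q is linear on the positive subspace only. *)
Lemma polarization (V : lmodType R[i]) (A : set V) (B : V -> V -> R[i]) :
  (forall a u v, A u -> A v -> A (a *: u + v)) ->
  (forall a u v w, A u -> A v -> A w -> B (a *: u + v) w = a * B u w + B v w) ->
  (forall a u v w, A u -> A v -> A w -> B w (a *: u + v) = a^* * B w u + B w v) ->
  (forall u, A u -> B u u = 0) -> forall u v, A u -> A v -> B u v = 0.
Proof.
move=> AP Bl Br B0 u v Au Av.
have h a : a * B u v + a^* * B v u = 0.
  have := B0 _ (AP a _ _ Au Av).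
  rewrite Bl// ?Br//; try exact: AP.
  by rewrite !B0// mulr0 add0r addr0 => <-; ring.
have h1 := h 1; have hi := h 'i.
rewrite conjC1 !mul1r in h1.
have /eqP := hi; rewrite conjCi mulNr -mulrBr mulf_eq0 (negPf (neq0Ci _)) /= subr_eq0.
move=> /eqP e; rewrite -e -mulr2n in h1.
by have /eqP := h1; rewrite mulrn_eq0 => /eqP.
Qed.


Lemma norm_isometry (V W : hilbertType R) (f : {linear V -> W}) :
  (forall v, `|f v| = `|v|) -> isometry hdot hdot f.
Proof.
move=> fn u v; apply/subr0_eq.
apply: (@polarization V setT (fun u v => '[f u, f v] - '[u, v])) => //.
- by move=> a x y w _ _ _; rewrite linearP !hdotDl !hdotZl; ring.
- by move=> a x y w _ _ _; rewrite linearP !hdotDr !hdotZr; ring.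
- by move=> x _; rewrite !hdotE fn subrr.
Qed.

Lemma isometry_hdot (V W : hilbertType R) (f : {linear V -> W}) :
  isometry hdot hdot f -> forall u v, '[f u, f v] = '[u, v].
Proof. by []. Qed.

Lemma isometry_norm (V W : hilbertType R) (f : {linear V -> W}) :
  isometry hdot hdot f -> forall v, `|f v| = `|v|.
Proof.
by move=> fi v; apply/eqP; rewrite -(eqrXn2 (ltn0Sn 1))// -!hdotE fi.
Qed.

Lemma isometry_continuous (V W : hilbertType R) (f : {linear V -> W}) :
  isometry hdot hdot f -> continuous f.
Proof.
move=> fi; apply: (@lipschitz_continuous _ _ _ _ 1) => // v.
by rewrite mul1r isometry_norm.
Qed.

Definition total_family (I : Type) (V : hilbertType R) (a : I -> V) :=
  forall v, closure (lspan (range a)) v.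

Lemma eq_on_total (I : Type) (V W : hilbertType R) (a : I -> V)
    (f g : {linear V -> W}) :
  total_family a -> continuous f -> continuous g ->
  (forall i, f (a i) = g (a i)) -> forall v, f v = g v.
Proof.
move=> ta cf cg fg v.
have := @closed_span_min _ _ (range a) _ (closed_subspace_eq cf cg) _ v (ta v).
by apply => _ [i _ <-].
Qed.

Lemma total_orthogonal (I : Type) (V : hilbertType R) (a : I -> V) :
  (forall v, (forall i, '[v, a i] = 0) -> v = 0) -> total_family a.
Proof.
move=> a0; apply: orthogonal_total => [|v va]; first exact: closed_subspace_span.
by apply: a0 => i; apply: va; exact: sub_closed_span.
Qed.

Section Combinations.
Variables (I : Type) (V : hilbertType R) (a : I -> V).

Definition lcomb (c : seq (R[i] * I)) : V := \sum_(p <- c) p.1 *: a p.2.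

Definition scomb z (c : seq (R[i] * I)) := [seq (z * p.1, p.2) | p <- c].

Lemma lcomb_cat c c' : lcomb (c ++ c') = lcomb c + lcomb c'.
Proof. by rewrite /lcomb big_cat. Qed.

Lemma lcomb_scale z c : lcomb (scomb z c) = z *: lcomb c.
Proof.
rewrite /lcomb big_map scaler_sumr; apply: eq_bigr => p _.
by rewrite scalerA.
Qed.

Lemma lspan_lcomb : lspan (range a) `<=` range lcomb.
Proof.
apply: lspan_min => [|_ [i _ <-]].
  apply/linear_subspaceP; split; first by exists [::] => //; rewrite /lcomb big_nil.
  move=> z _ _ [c _ <-] [c' _ <-]; exists (scomb z c ++ c') => //.
  by rewrite lcomb_cat lcomb_scale.
by exists [:: (1, i)] => //; rewrite /lcomb big_seq1 scale1r.
Qed.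

End Combinations.

Section Gram.
Variables (I : Type) (V W : hilbertType R) (a : I -> V) (b : I -> W).

(** The closure in V * W of the set of pairs of corresponding linear combinations:
    the graph of the isometry that sends each a i to b i. *)
Definition gram_graph (x : V) (y : W) : Prop := forall e : R[i], 0 < e ->
  exists c, `|x - lcomb a c| <= e /\ `|y - lcomb b c| <= e.

Hypothesis ab : forall i j, '[a i, a j] = '[b i, b j].

Lemma lcomb_norm c : `|lcomb a c| = `|lcomb b c|.
Proof.
apply/eqP; rewrite -(eqrXn2 (ltn0Sn 1))// -!hdotE; apply/eqP.
rewrite !hdot_suml; apply: eq_bigr => p _; rewrite !hdot_sumr.
by apply: eq_bigr => q _; rewrite !hdotZl !hdotZr ab.
Qed.

Lemma lcomb_dist c c' : `|lcomb a c - lcomb a c'| = `|lcomb b c - lcomb b c'|.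
Proof.
have := lcomb_norm (c ++ scomb (-1) c').
by rewrite !lcomb_cat !lcomb_scale !scaleN1r.
Qed.

Lemma gram_graph_linear z x x' y y' :
  gram_graph x y -> gram_graph x' y' -> gram_graph (z *: x + x') (z *: y + y').
Proof.
move=> xy xy' e e0.
have z1 : 0 < `|z| + 1 by rewrite ltr_wpDl.
have e1 : 0 < e / 2 / (`|z| + 1) by rewrite !divr_gt0.
have e2 : 0 < e / 2 by rewrite divr_gt0.
have [c [xc yc]] := xy _ e1; have [c' [xc' yc']] := xy' _ e2.
exists (scomb z c ++ c'); rewrite !lcomb_cat !lcomb_scale.
have h (X : hilbertType R) (u u' v v' : X) :
    `|u - v| <= e / 2 / (`|z| + 1) -> `|u' - v'| <= e / 2 ->
    `|z *: u + u' - (z *: v + v')| <= e.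
  move=> uv uv'; rewrite opprD addrACA -scalerBr [e]splitr.
  apply: le_trans (ler_normD _ _) _; apply: lerD => //; rewrite normrZ.
  rewrite ler_pdivlMr// in uv; apply: le_trans uv.
  by rewrite mulrC ler_wpM2l// lerDl.
by split; exact: h.
Qed.

Lemma gram_graph_norm_le x y : gram_graph x y -> `|x| <= `|y| /\ `|y| <= `|x|.
Proof.
move=> xy; have h (X Y : hilbertType R) (u u' : X) (v v' : Y) (e : R[i]) :
    `|u - u'| <= e -> `|v - v'| <= e -> `|u'| = `|v'| -> `|u| <= e + e + `|v|.
  move=> uu' vv' n; rewrite -[u](subrK u'); apply: le_trans (ler_normD _ _) _.
  rewrite -addrA; apply: lerD => //; rewrite n -[v'](subrK v).
  by apply: le_trans (ler_normD _ _) _; rewrite lerD2r distrC.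
by split; apply/ler_addgt0Pl => e e0;
  have [c [xc yc]] := xy (e / 2) (divr_gt0 e0 (ltr0n _ 2));
  rewrite [e]splitr; [apply: h xc yc _|apply: h yc xc _]; rewrite lcomb_norm.
Qed.

Lemma gram_graph_norm x y : gram_graph x y -> `|x| = `|y|.
Proof. by move=> /gram_graph_norm_le[xy yx]; apply/le_anti; rewrite xy. Qed.

Lemma gram_graph_inj x y y' : gram_graph x y -> gram_graph x y' -> y = y'.
Proof.
move=> xy xy'; have := gram_graph_norm (gram_graph_linear (-1) xy xy').
by rewrite !scaleN1r addNr normr0 addrC => /esym/normr0_eq0/subr0_eq.
Qed.

Lemma gram_graph_total : total_family a -> forall x, exists y, gram_graph x y.
Proof.
move=> ta x.
pose P (e : R[i]) y := exists c, `|x - lcomb a c| <= e /\ `|y - lcomb b c| <= e.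
have [|||y Hy] := @nested_complete _ _ P.
- move=> e e0; have /closureP/(_ e e0)[v /lspan_lcomb[c _ <-] xv] := ta x.
  by exists (lcomb b c), c; rewrite subrr normr0 !ltW.
- by move=> e e' y ee' [c [xc yc]]; exists c; split; apply: le_trans ee'.
- move=> d d0; exists (d / 4); first by rewrite divr_gt0.
  move=> y y' [c [xc yc]] [c' [xc' yc']].
  have -> : d = d / 4 + (d / 4 + d / 4 + d / 4) by field.
  rewrite -(subrKA (lcomb b c)); apply: le_trans (ler_normD _ _) (lerD yc _).
  rewrite -(subrKA (lcomb b c')); apply: le_trans (ler_normD _ _) _.
  rewrite [X in _ + X]distrC lerD//.
  rewrite -lcomb_dist -(subrKA x); apply: le_trans (ler_normD _ _) _.
  by rewrite lerD// distrC.
exists y => e e0; have [e' [e'0 e'e He']] := Hy _ (divr_gt0 e0 (ltr0n _ 2)).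
have /closureP/(_ e' e'0)[v /lspan_lcomb[c _ <-] xv] := ta x.
have e2e : e / 2 <= e by rewrite ler_pdivrMr// ler_pMr// ler1n.
exists c; split; first exact: le_trans (ltW xv) (le_trans e'e e2e).
by apply: le_trans e2e; apply: He'; exists c; rewrite subrr normr0 !ltW.
Qed.

End Gram.

Lemma gram_graph_sym (I : Type) (V W : hilbertType R) (a : I -> V) (b : I -> W) x y :
  gram_graph a b x y -> gram_graph b a y x.
Proof. by move=> xy e /xy[c [? ?]]; exists c. Qed.

(** The closure of the graph is symmetric in the two families, so the inverse is
    obtained by exchanging them. *)
Theorem gram_unitary (I : Type) (V W : hilbertType R) (a : I -> V) (b : I -> W) :
  (forall i j, '[a i, a j] = '[b i, b j]) -> total_family a -> total_family b ->
  exists F : {linear V -> W}, unitary F /\ forall i, F (a i) = b i.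
Proof.
move=> ab ta tb; have ba i j : '[b i, b j] = '[a i, a j] by rewrite ab.
have [f fG] := choice (gram_graph_total ab ta).
have [g gG] := choice (gram_graph_total ba tb).
have lf : linear f.
  move=> z u v; apply: (gram_graph_inj ab) (fG _) _.
  exact: gram_graph_linear.
have [F Ff] := linear_bundle lf; exists F; split; last first.
  move=> i; rewrite Ff; apply: (gram_graph_inj ab) (fG _) _ => e e0.
  exists [:: (1, i)]; rewrite /lcomb !big_seq1 !scale1r !subrr !normr0.
  by rewrite ltW.
split; first by apply: norm_isometry => v; rewrite Ff; exact/esym/(gram_graph_norm ab).
exists g => [v|w].
  by apply: (gram_graph_inj ba) (gG _) _; rewrite Ff; exact: gram_graph_sym.
by rewrite Ff; apply: (gram_graph_inj ab) (fG _) _; exact: gram_graph_sym.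
Qed.

End Isometries.

(** * Limits of complex numbers *)

Section ComplexLimits.
Variable R : realType.

(** The real and the imaginary part converge separately. *)
Lemma nested_complete_complex (P : R[i] -> R[i] -> Prop) :
  (forall e : R[i], 0 < e -> exists v, P e v) ->
  (forall (e e' : R[i]) v, e <= e' -> P e v -> P e' v) ->
  (forall d : R[i], 0 < d -> exists2 e : R[i], 0 < e &
    forall v w, P e v -> P e w -> `|v - w| <= d) ->
  exists l, forall d : R[i], 0 < d ->
    exists e : R[i], [/\ 0 < e, e <= d & forall v, P e v -> `|l - v| <= d].
Proof.
move=> Pne Pmono Pdiam.
have part (g : {additive R[i] -> R}) : (forall z, `|g z|%:C <= `|z|) ->
    exists l : R, forall d : R, 0 < d ->
    exists e : R, [/\ 0 < e, e <= d & forall v, P e%:C v -> `|l - g v| <= d].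
  move=> gle.
  have [|||l Hl] := @nested_complete R R (fun e x => exists2 z, P e%:C z & x = g z).
  - move=> e e0; have [|z Pz] := Pne e%:C; first by rewrite ltcR.
    by exists (g z), z.
  - by move=> e e' _ ee' [z Pz ->]; exists z => //; apply: Pmono Pz; rewrite lecR.
  - move=> d d0; have dC : 0 < d%:C by rewrite ltcR.
    have [e /gt0_real_complex[r r0 ->] Hr] := Pdiam _ dC.
    exists r => // _ _ [z Pz ->] [w Pw ->]; rewrite -lecR -raddfB.
    by apply: le_trans (gle _) _; exact: Hr.
  exists l => d d0; have [e [e0 ed He]] := Hl _ d0.
  by exists e; split=> // v Pv; apply: He; exists v.
have normi : `|Complex 0 1 : R[i]| = 1.
  by rewrite normc_def /= expr0n expr1n add0r sqrtr1.
have Im_le (z : R[i]) : `|complex.Im z|%:C <= `|z|.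
  by rewrite -(normrN (complex.Im z)) -ReiNIm; apply: le_trans (normc_ge_Re _) _;
    rewrite normrM normi mulr1.
have [x Hx] := part (@complex.Re R) (@normc_ge_Re R).
have [y Hy] := part (@complex.Im R) Im_le.
exists (Complex x y) => d /gt0_real_complex[r r0 ->].
have r2 : 0 < r / 2 by rewrite divr_gt0.
have [e [e0 er He]] := Hx _ r2; have [e' [e'0 e'r He']] := Hy _ r2.
have [m [m0 me me']] : exists m : R, [/\ 0 < m, m <= e & m <= e'].
  by exists (Num.min e e'); rewrite lt_min e0 e'0 !ge_min !lexx orbT.
exists m%:C; split; [by rewrite ltcR|by rewrite lecR; lra|move=> v Pv].
have Hv1 := He _ (Pmono _ e%:C _ (etrans (lecR _ _) me) Pv).
have Hv2 := He' _ (Pmono _ e'%:C _ (etrans (lecR _ _) me') Pv).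
rewrite [X in `|X|]complexE; apply: le_trans (ler_normD _ _) _.
rewrite normrM normi mul1r !raddfB /=.
have nR (u : R) : `|u%:C| = `|u|%:C.
  by rewrite normc_def /= expr0n addr0 sqrtr_sqr.
by rewrite -!rmorphB !nR -rmorphD lecR; lra.
Qed.

Lemma exists_small (d M : R[i]) : 0 < d -> 0 < M ->
  exists e : R[i], [/\ 0 < e, e <= 1 & e * M <= d].
Proof.
move=> d0 M0; have dM : 0 < d / M by rewrite divr_gt0.
have [h|h] := le_total_pos ltr01 dM.
  by exists 1; split=> //; rewrite -ler_pdivlMr.
by exists (d / M); split=> //; rewrite divfK// gt_eqF.
Qed.

Lemma norm_le_all0 (x : R[i]) : (forall e : R[i], 0 < e -> `|x| <= e) -> x = 0.
Proof.
move=> h; apply/eqP; rewrite -normr_eq0; apply/eqP/le_anti.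
by rewrite normr_ge0 andbT; apply/ler_addgt0Pl => e /h; rewrite addr0.
Qed.

Lemma continuous_bounded (V W : hilbertType R) (f : {linear V -> W}) :
  continuous f -> exists2 M : R[i], 0 < M & forall v, `|f v| <= M * `|v|.
Proof.
move=> cf; have /linear_boundedP : bounded_near f (nbhs 0).
  exact/linear_bounded_continuous.
by move=> /pinfty_ex_gt0[M M0 HM]; exists M.
Qed.

End ComplexLimits.

(** * The Gram form of a positive definite kernel *)

(** Positivity is bundled with the kernel so that the Hilbert space structure built
    from it can be inferred from the kernel alone. *)
Record pdKernel (R : realType) (H : hilbertType R) (T : Type) := PdKernel {
  kernel :> T -> T -> {linear H -> H};
  kernelP : pos_def_kernel kernel
}.

Section PreHilbert.
Variables (R : realType) (H : hilbertType R) (T : Type) (K : pdKernel H T).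
Implicit Types (f g h : T -> H) (c d : seq (T * H)) (z : R[i]).

(** A pair (t, v) in the list c stands for the kernel function K(., t) v, and c for
    the sum of these functions. *)
Definition ksum c : T -> H := fun s => \sum_(p <- c) K s p.1 p.2.

(** By the reproducing property this is the inner product of f with the combination
    c, defined before there is an inner product and for every function f. *)
Definition pairing f c : R[i] := \sum_(p <- c) '[f p.1, p.2].

Definition kscale z c : seq (T * H) := [seq (p.1, z *: p.2) | p <- c].

Definition gram c d := pairing (ksum c) d.

Lemma ksum_cat c d : ksum (c ++ d) = ksum c + ksum d.
Proof. by apply/funext => s; rewrite /ksum big_cat. Qed.

Lemma ksum_scale z c : ksum (kscale z c) = z *: ksum c.
Proof.
apply/funext => s; rewrite /ksum big_map /= [RHS]scaler_sumr.
by apply: eq_bigr => p _; rewrite linearZ.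
Qed.

Lemma pairing_cat f c d : pairing f (c ++ d) = pairing f c + pairing f d.
Proof. exact: big_cat. Qed.

Lemma pairing_scale f z c : pairing f (kscale z c) = z^* * pairing f c.
Proof.
rewrite /pairing big_map mulr_sumr; apply: eq_bigr => p _.
by rewrite hdotZr.
Qed.

Lemma pairingP z f g c : pairing (z *: f + g) c = z * pairing f c + pairing g c.
Proof.
rewrite /pairing mulr_sumr -big_split; apply: eq_bigr => p _.
by rewrite /= hdotDl hdotZl.
Qed.

Lemma pairingN f c : pairing (- f) c = - pairing f c.
Proof.
have := pairingP (-1) f 0 c.
rewrite scaleN1r addr0 mulN1r => ->; rewrite /pairing [X in _ + X]big1 ?addr0//.
by move=> p _; exact: hdot0l.
Qed.

Lemma pairingB f g c : pairing (f - g) c = pairing f c - pairing g c.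
Proof.
have := pairingP (-1) g f c.
by rewrite scaleN1r mulN1r addrC [RHS]addrC.
Qed.

Lemma gram_ge0 c : 0 <= gram c c.
Proof.
case: c => [|p c]; first by rewrite /gram /pairing big_nil.
move: (p :: c) => {}c; have := (kernelP K).2 (size c)
  (fun i => (nth p c i).1) (fun i => (nth p c i).2).
congr (0 <= _); rewrite /gram /pairing (big_nth p) big_mkord.
apply: eq_bigr => i _; rewrite /ksum (big_nth p) big_mkord hdot_suml.
by [].
Qed.

Lemma gram_quadratic c d z : gram (c ++ kscale z d) (c ++ kscale z d) =
  gram c c + (z^* * gram c d + z * gram d c) + z * z^* * gram d d.
Proof.
rewrite /gram pairing_cat pairing_scale ksum_cat ksum_scale addrC.
by rewrite ![ksum c + _]addrC !pairingP; ring.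
Qed.

(** Positivity alone makes the form hermitian: the cross terms of the nonnegative
    number gram (c + z d, c + z d) are real for z = 1 and for z = i. *)
Lemma gramC c d : gram c d = (gram d c)^*.
Proof.
have h z : z^* * gram c d + z * gram d c \is Num.real.
  have -> : z^* * gram c d + z * gram d c =
      gram (c ++ kscale z d) (c ++ kscale z d) - gram c c - z * z^* * gram d d.
    by rewrite gram_quadratic; ring.
  by rewrite !realB// ger0_real ?gram_ge0// mulr_ge0 ?mul_conjC_ge0 ?gram_ge0.
have /CrealP := h 1; have /CrealP := h 'i.
rewrite !rmorphD !rmorphM /= !conjCK conjCi !conjC1 !mul1r => hi h1.
move: hi h1; set a := gram c d; set b := gram d c => hi h1.
have : 'i * (a^* - b^*) = 'i * (b - a).
  by rewrite mulrBr -mulNr hi; ring.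
move=> /(mulfI (neq0Ci _)) ab; have : 2 * a^* = 2 * b.
  rewrite (_ : 2 * a^* = (a^* + b^*) + (a^* - b^*)); last by ring.
  by rewrite h1 ab; ring.
have n2 : 2 != 0 :> R[i] by rewrite pnatr_eq0.
by move=> /(mulfI n2) <-; rewrite conjCK.
Qed.

Definition knorm c : R[i] := sqrtC (gram c c).

Lemma knorm_ge0 c : 0 <= knorm c.
Proof. by rewrite sqrtC_ge0 gram_ge0. Qed.

Lemma knormK c : knorm c ^+ 2 = gram c c.
Proof. exact: sqrtCK. Qed.

(** f has norm at most e as an antilinear functional on the formal combinations. *)
Definition bound_by (e : R[i]) f := forall c, `|pairing f c| <= e * knorm c.

Lemma bound_by_le e e' f : e <= e' -> bound_by e f -> bound_by e' f.
Proof.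
by move=> ee' fe c; apply: le_trans (fe c) _; rewrite ler_wpM2r// knorm_ge0.
Qed.

Lemma bound_byP z e e' f g :
  bound_by e f -> bound_by e' g -> bound_by (`|z| * e + e') (z *: f + g).
Proof.
move=> fe ge c; rewrite pairingP; apply: le_trans (ler_normD _ _) _.
by rewrite mulrDl lerD// normrM -mulrA ler_wpM2l.
Qed.

Lemma bound_byN e f : bound_by e f -> bound_by e (- f).
Proof. by move=> fe c; rewrite pairingN normrN. Qed.

Lemma bound_byD e e' f g :
  bound_by e f -> bound_by e' g -> bound_by (e + e') (f + g).
Proof. by move=> fe ge; have := bound_byP 1 fe ge; rewrite normr1 mul1r scale1r. Qed.

Lemma bound_byB e e' f g :
  bound_by e f -> bound_by e' g -> bound_by (e + e') (f - g).
Proof. by move=> fe /bound_byN; exact: bound_byD. Qed.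

Lemma bound_by_dist e e' f g h :
  bound_by e (f - g) -> bound_by e' (f - h) -> bound_by (e + e') (g - h).
Proof.
move=> fg fh; rewrite (_ : g - h = (f - h) - (f - g)); last first.
  by rewrite [RHS]addrC opprB subrKA.
by rewrite addrC; exact: bound_byB.
Qed.

(** The Cauchy-Schwarz inequality for the Gram form. *)
Lemma bound_by_ksum c : bound_by (knorm c) (ksum c).
Proof.
move=> d; rewrite -(ler_pXn2r (ltn0Sn 1)) ?nnegrE ?mulr_ge0 ?knorm_ge0//.
rewrite exprMn !knormK; apply: discriminant_le => [|z]; first exact: gram_ge0.
by rewrite -/(gram c d) -gramC -gram_quadratic gram_ge0.
Qed.

Lemma knorm_le e c : 0 <= e -> bound_by e (ksum c) -> knorm c <= e.
Proof.
move=> e0 /(_ c); rewrite -/(gram c c) ger0_norm ?gram_ge0// -knormK expr2.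
have [->//|n0] := eqVneq (knorm c) 0.
by rewrite ler_pM2r// lt_def n0 knorm_ge0.
Qed.

Lemma knorm_dist_le e c d : 0 <= e -> bound_by e (ksum c - ksum d) ->
  `|knorm c - knorm d| <= e.
Proof.
move=> e0 cd; have h c' d' : bound_by e (ksum c' - ksum d') ->
    knorm c' <= e + knorm d'.
  move=> ?; apply: knorm_le; first by rewrite addr_ge0 ?knorm_ge0.
  rewrite -[ksum c'](subrK (ksum d')).
  by apply: bound_byD => //; exact: bound_by_ksum.
have dc : bound_by e (ksum d - ksum c) by rewrite -opprB; exact: bound_byN.
have r c' : knorm c' \is Num.real by rewrite ger0_real ?knorm_ge0.
rewrite real_ler_norml ?realB//; apply/andP; split; last by rewrite lerBlDr h.
by rewrite lerNl opprB lerBlDr h.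
Qed.

(** The closure, in the dual norm, of the span of the kernel functions.  Its elements
    are functions, so the completion needs no quotient. *)
Definition rkhs_pred : {pred T -> H} :=
  fun f => `[< forall e : R[i], 0 < e -> exists c, bound_by e (f - ksum c) >].

Lemma rkhs_predP f : reflect
  (forall e : R[i], 0 < e -> exists c, bound_by e (f - ksum c)) (f \in rkhs_pred).
Proof. exact: asboolP. Qed.

Lemma bound_by0 e : 0 <= e -> bound_by e 0.
Proof.
move=> e0 c; rewrite /pairing big1 ?normr0 ?mulr_ge0 ?knorm_ge0// => p _.
exact: hdot0l.
Qed.

Lemma rkhs_pred_ksum c : ksum c \in rkhs_pred.
Proof.
by apply/rkhs_predP => e e0; exists c; rewrite subrr; apply: bound_by0; exact: ltW.
Qed.

Lemma rkhs_pred_submod : GRing.submod_closed rkhs_pred.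
Proof.
split=> [|z f g /rkhs_predP hf /rkhs_predP hg].
  rewrite (_ : 0 = ksum [::]); first exact: rkhs_pred_ksum.
  by apply/funext => s; rewrite /ksum big_nil.
apply/rkhs_predP => e e0.
have z1 : 0 < `|z| + 1 by rewrite ltr_wpDl.
have e2 : 0 < e / 2 by rewrite divr_gt0.
have [c fc] := hf _ (divr_gt0 e2 z1); have [d gd] := hg _ e2.
exists (kscale z c ++ d); rewrite ksum_cat ksum_scale opprD addrACA -scalerBr.
apply: bound_by_le (bound_byP z fc gd).
rewrite [leRHS]splitr lerD2r mulrCA ger_pMr// ler_pdivrMr//.
by rewrite mul1r lerDl.
Qed.

(** The Gram form is Lipschitz on combinations of bounded norm, so it converges along
    any two approximations; the limit is the inner product of f and g. *)
Lemma gram_limit f g : f \in rkhs_pred -> g \in rkhs_pred ->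
  exists l, forall d : R[i], 0 < d -> exists e : R[i], [/\ 0 < e, e <= d &
    forall c c', bound_by e (f - ksum c) -> bound_by e (g - ksum c') ->
      `|l - gram c c'| <= d].
Proof.
move=> /rkhs_predP hf /rkhs_predP hg.
pose P (e : R[i]) z :=
  exists c c', [/\ bound_by e (f - ksum c), bound_by e (g - ksum c') & z = gram c c'].
have [|||l Hl] := @nested_complete_complex _ P.
- move=> e e0; have [c fc] := hf e e0; have [c' gc'] := hg e e0.
  by exists (gram c c'), c, c'.
- move=> e e' z ee' [c [c' [fc gc' ->]]]; exists c, c'.
  by split=> //; exact: bound_by_le ee' _.
- move=> d d0; have [c0 fc0] := hf 1 ltr01; have [d0' gd0] := hg 1 ltr01.
  pose M := knorm c0 + knorm d0' + 4.
  have M0 : 0 < M by rewrite ltr_wpDl ?addr_ge0 ?knorm_ge0.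
  have [e [e0 e1 eM]] := exists_small d0 (mulr_gt0 (ltr0n _ 2) M0).
  exists e => // _ _ [c [c' [fc gc' ->]]] [b [b' [fb gb' ->]]].
  have near h (x y : seq (T * H)) : bound_by e (h - ksum x) ->
      bound_by 1 (h - ksum y) -> knorm x <= knorm y + 2.
    move=> hx hy; rewrite -lerBlDl; apply: le_trans (real_ler_norm _) _.
      by rewrite realB// ger0_real ?knorm_ge0.
    apply: knorm_dist_le => //; apply: bound_by_le (bound_by_dist hx hy).
    by rewrite -[2](natrD _ 1 1) lerD2r.
  rewrite -(subrKA (gram b c')); apply: le_trans (ler_normD _ _) _.
  apply: le_trans eM.
  have -> : e * (2 * M) = (e + e) * (knorm d0' + 2) + (e + e) * (knorm c0 + 2).
    by rewrite /M; ring.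
  have ee : 0 <= e + e by rewrite addr_ge0 ?ltW.
  apply: lerD.
    rewrite /gram -pairingB; apply: le_trans (bound_by_dist fc fb _) _.
    by rewrite ler_wpM2l//; exact: near gc' gd0.
  rewrite gramC [gram b b']gramC -rmorphB norm_conjC.
  rewrite /gram -pairingB; apply: le_trans (bound_by_dist gc' gb' _) _.
  by rewrite ler_wpM2l//; exact: near fb fc0.
exists l => d d0; have [e [e0 ed He]] := Hl d d0.
by exists e; split=> // c c' fc gc'; apply: He; exists c, c'.
Qed.

Lemma knorm_limit f : f \in rkhs_pred -> exists2 n : R[i], 0 <= n &
  forall d : R[i], 0 < d -> exists e : R[i], [/\ 0 < e, e <= d &
    forall c, bound_by e (f - ksum c) -> `|n - knorm c| <= d].
Proof.
move=> /rkhs_predP hf.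
pose P (e : R[i]) z := exists2 c, bound_by e (f - ksum c) & z = knorm c.
have [|||n Hn] := @nested_complete_complex _ P.
- by move=> e e0; have [c fc] := hf e e0; exists (knorm c), c.
- by move=> e e' z ee' [c fc ->]; exists c => //; exact: bound_by_le ee' _.
- move=> d d0; have d2 : 0 < d / 2 by rewrite divr_gt0.
  exists (d / 2) => // _ _ [c fc ->] [c' fc' ->].
  apply: knorm_dist_le; first exact: ltW.
  by rewrite [d]splitr; exact: bound_by_dist.
(* The limit of the nonnegative numbers knorm c is replaced by its modulus, which is
   nonnegative by construction. *)
exists `|n| => // d d0; have [e [e0 ed He]] := Hn d d0.
exists e; split=> // c fc; rewrite -[knorm c]ger0_norm ?knorm_ge0//.
by apply: le_trans (ler_dist_dist _ _) _; apply: He; exists c.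
Qed.

Lemma bound_by_limit n f : (forall e : R[i], 0 < e -> bound_by (n + e) f) ->
  bound_by n f.
Proof.
move=> nf c; apply/ler_addgt0Pl => e e0.
have k1 : 0 < knorm c + 1 by rewrite ltr_wpDl ?knorm_ge0.
apply: le_trans (nf _ (divr_gt0 e0 k1) c) _.
rewrite mulrDl addrC lerD2r -mulrA ger_pMr// ler_pdivrMl// mulr1.
by rewrite lerDl.
Qed.

(** The norm is needed both as a least bound, which gives the triangle inequality,
    and as a limit, which identifies its square with the inner product. *)
Lemma dual_norm f : f \in rkhs_pred -> exists n : R[i],
  [/\ 0 <= n, bound_by n f, (forall M, 0 <= M -> bound_by M f -> n <= M) &
   forall d : R[i], 0 < d -> exists e : R[i], [/\ 0 < e, e <= d &
    forall c, bound_by e (f - ksum c) -> `|n - knorm c| <= d]].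
Proof.
move=> fP; have /rkhs_predP hf := fP; have [n n0 Hn] := knorm_limit fP.
have nr : n \is Num.real by exact: ger0_real.
have kr c : knorm c \is Num.real by rewrite ger0_real ?knorm_ge0.
exists n; split=> //.
  apply: bound_by_limit => d d0; have d2 : 0 < d / 2 by rewrite divr_gt0.
  have [e [e0 ed He]] := Hn _ d2; have [c fc] := hf _ e0.
  rewrite -[f](subrK (ksum c)).
  apply: bound_by_le (bound_byD fc (@bound_by_ksum c)).
  rewrite [d]splitr addrC addrA lerD// -lerBlDl.
  by apply: le_trans (real_ler_norm _) _; rewrite ?realB// distrC He.
move=> M M0 fM; apply/ler_addgt0Pl => d d0.
have d2 : 0 < d / 2 by rewrite divr_gt0.
have [e [e0 ed He]] := Hn _ d2; have [c fc] := hf _ e0.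
have kM : knorm c <= M + e.
  apply: knorm_le; first by rewrite addr_ge0// ltW.
  by rewrite -[ksum c](subKr f); exact: bound_byB.
have : n <= d / 2 + knorm c.
  by rewrite -lerBlDr; apply: le_trans (real_ler_norm _) _; rewrite ?realB// He.
move=> /le_trans; apply; rewrite [X in _ <= X + M]splitr -addrA lerD2l addrC.
by apply: le_trans kM _; rewrite lerD2l.
Qed.

Definition kdot f g : R[i] := xget 0 [set l | forall d : R[i], 0 < d ->
  exists e : R[i], [/\ 0 < e, e <= d &
    forall c c', bound_by e (f - ksum c) -> bound_by e (g - ksum c') ->
      `|l - gram c c'| <= d]].

Lemma kdotP f g : f \in rkhs_pred -> g \in rkhs_pred ->
  forall d : R[i], 0 < d -> exists e : R[i], [/\ 0 < e, e <= d &
    forall c c', bound_by e (f - ksum c) -> bound_by e (g - ksum c') ->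
      `|kdot f g - gram c c'| <= d].
Proof.
move=> fP gP; rewrite /kdot; case: xgetP => [l -> //|h].
by have [l /h] := gram_limit fP gP.
Qed.

(** The Cauchy-Schwarz inequality for f and g - ksum b.  As b does not depend on f,
    it transfers the linearity of the pairing in f to the inner product. *)
Lemma kdot_pairing M e f g b : f \in rkhs_pred -> g \in rkhs_pred ->
  0 <= M -> 0 <= e -> bound_by M f -> bound_by e (g - ksum b) ->
  `|kdot f g - pairing f b| <= M * e.
Proof.
move=> fP gP M0 e0 fM gb; apply/ler_addgt0Pl => d d0.
have /rkhs_predP hf := fP; have /rkhs_predP hg := gP.
have X0 : 0 < 2 + M + e + knorm b.
  by rewrite ltr_wpDr ?knorm_ge0// ltr_wpDr// ltr_wpDr.
have [x [x0 x1 xX]] := exists_small d0 X0.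
have [y [y0 yx Hy]] := kdotP fP gP x0.
have [c fc] := hf _ y0; have [c' gc'] := hg _ y0.
have kc : knorm c <= M + y.
  apply: knorm_le; first by rewrite addr_ge0// ltW.
  by rewrite -[ksum c](subKr f); exact: bound_byB.
have -> : kdot f g - pairing f b =
    kdot f g - gram c c' + (gram c c' - gram c b) - (pairing f b - gram c b).
  by ring.
apply: le_trans (ler_normB _ _) _.
apply: le_trans (lerD (ler_normD _ _) (lexx _)) _.
have h1 := Hy _ _ fc gc'.
have h2 : `|gram c c' - gram c b| <= (y + e) * (M + y).
  rewrite gramC [gram c b]gramC -rmorphB norm_conjC /gram -pairingB.
  apply: le_trans (bound_by_dist gc' gb _) _.
  by rewrite ler_wpM2l// addr_ge0// ltW.
have h3 : `|pairing f b - gram c b| <= y * knorm b.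
  by rewrite /gram -pairingB; exact: fc.
apply: le_trans (lerD (lerD h1 h2) h3) _.
apply: (@le_trans _ _ (x + (x + e) * (M + x) + x * knorm b)).
  have [x0' y0'] := (ltW x0, ltW y0).
  rewrite lerD ?ler_wpM2r ?knorm_ge0// lerD// ler_pM ?addr_ge0// ?lerD2r ?lerD2l//.
have -> : x + (x + e) * (M + x) + x * knorm b =
    M * e + x * (1 + x + M + e + knorm b) by ring.
rewrite addrC lerD2r; apply: le_trans xX; rewrite ler_wpM2l ?(ltW x0)//.
by rewrite !lerD2r -[2](natrD _ 1 1) lerD2l.
Qed.

Lemma kdot_ksum f c : f \in rkhs_pred -> kdot f (ksum c) = pairing f c.
Proof.
move=> fP; have [n [n0 fn _ _]] := dual_norm fP.
have := kdot_pairing fP (rkhs_pred_ksum c) n0 (lexx 0) fn (b := c).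
rewrite subrr mulr0 => /(_ (bound_by0 (lexx 0))) h.
by apply/subr0_eq/norm_le_all0 => e /ltW; exact: le_trans.
Qed.

Lemma rkhs_predZD z f g : f \in rkhs_pred -> g \in rkhs_pred ->
  z *: f + g \in rkhs_pred.
Proof. exact: rkhs_pred_submod.2. Qed.

Lemma kdotPl z f f' g : f \in rkhs_pred -> f' \in rkhs_pred -> g \in rkhs_pred ->
  kdot (z *: f + f') g = z * kdot f g + kdot f' g.
Proof.
move=> fP f'P gP; have hP := rkhs_predZD z fP f'P.
have [n [n0 fn _ _]] := dual_norm fP; have [n' [n'0 fn' _ _]] := dual_norm f'P.
have [m [m0 hm _ _]] := dual_norm hP; have /rkhs_predP hg := gP.
apply/subr0_eq/norm_le_all0 => d d0.
have X0 : 0 < 1 + m + `|z| * n + n' by rewrite !ltr_wpDr// mulr_ge0.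
have [e [e0 _ eX]] := exists_small d0 X0; have [b gb] := hg e e0.
have e0' := ltW e0.
have h := kdot_pairing hP gP m0 e0' hm gb.
have h1 := kdot_pairing fP gP n0 e0' fn gb.
have h2 := kdot_pairing f'P gP n'0 e0' fn' gb.
have -> : kdot (z *: f + f') g - (z * kdot f g + kdot f' g) =
  (kdot (z *: f + f') g - pairing (z *: f + f') b) -
  (z * (kdot f g - pairing f b) + (kdot f' g - pairing f' b)).
  by rewrite pairingP; ring.
apply: le_trans (ler_normB _ _) _.
apply: le_trans (lerD h (ler_normD _ _)) _; rewrite normrM.
apply: le_trans (lerD (lexx _) (lerD (ler_wpM2l (normr_ge0 z) h1) h2)) _.
apply: le_trans eX; rewrite -subr_ge0.
by rewrite (_ : _ - _ = e)//; ring.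
Qed.

Lemma kdotC f g : f \in rkhs_pred -> g \in rkhs_pred -> kdot f g = (kdot g f)^*.
Proof.
move=> fP gP; have /rkhs_predP hf := fP; have /rkhs_predP hg := gP.
apply/subr0_eq/norm_le_all0 => d d0; have d2 : 0 < d / 2 by rewrite divr_gt0.
have [e [e0 _ He]] := kdotP fP gP d2; have [e' [e'0 _ He']] := kdotP gP fP d2.
have [x [x0 xe xe']] := exists_le_pos e0 e'0.
have [c fc] := hf x x0; have [b gb] := hg x x0.
rewrite -(subrKA (gram c b)) [d]splitr; apply: le_trans (ler_normD _ _) (lerD _ _).
  by apply: He; [exact: bound_by_le xe _|exact: bound_by_le xe _].
rewrite gramC -rmorphB norm_conjC distrC.
by apply: He'; [exact: bound_by_le xe' _|exact: bound_by_le xe' _].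
Qed.

Lemma dual_norm_kdot f : f \in rkhs_pred -> exists n : R[i],
  [/\ 0 <= n, bound_by n f, (forall M, 0 <= M -> bound_by M f -> n <= M) &
   kdot f f = n ^+ 2].
Proof.
move=> fP; have [n [n0 fn nM Hn]] := dual_norm fP.
have /rkhs_predP hf := fP.
exists n; split=> //; apply/subr0_eq/norm_le_all0 => d d0.
have X0 : 0 < 1 + n + n + 1 by rewrite !ltr_wpDr.
have [x [x0 x1 xX]] := exists_small d0 X0.
have [e [e0 _ He]] := kdotP fP fP x0; have [e' [e'0 _ He']] := Hn _ x0.
have [y [y0 ye ye']] := exists_le_pos e0 e'0.
have [c fc] := hf y y0.
have h1 := He _ _ (bound_by_le ye fc) (bound_by_le ye fc).
have h2 := He' _ (bound_by_le ye' fc).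
rewrite -(subrKA (gram c c)); apply: le_trans (ler_normD _ _) _.
apply: le_trans xX; rewrite -!addrA mulrDr mulr1 lerD//.
rewrite -knormK subr_sqr normrM distrC ler_pM//.
rewrite ger0_norm ?addr_ge0 ?knorm_ge0// [leLHS]addrC lerD2l.
rewrite -lerBlDl; apply: le_trans (real_ler_norm _) _.
  by rewrite realB// ger0_real ?knorm_ge0.
by rewrite distrC; exact: le_trans x1.
Qed.

Lemma bound_by0_eq f : bound_by 0 f -> f = 0.
Proof.
move=> f0; apply/funext => s; apply: hdot_eq0.
have := f0 [:: (s, f s)]; rewrite mul0r /pairing big_seq1 /=.
by rewrite normr_le0 => /eqP.
Qed.

End PreHilbert.

(** * The reproducing kernel Hilbert space *)

Section Rkhs.
Variables (R : realType) (H : hilbertType R) (T : Type) (K : pdKernel H T).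

Record rkhs := Rkhs { rkhs_val :> T -> H; rkhs_valP : rkhs_val \in rkhs_pred K }.

HB.instance Definition _ := [isSub for rkhs_val].
HB.instance Definition _ := gen_eqMixin rkhs.
HB.instance Definition _ := gen_choiceMixin rkhs.
HB.instance Definition _ := GRing.isSubmodClosed.Build _ _ (rkhs_pred K)
  (rkhs_pred_submod K).
HB.instance Definition _ := [SubChoice_isSubLmodule of rkhs by <:].

Definition rkhs_norm (f : rkhs) : R[i] := sqrtC (kdot K f f).

Lemma rkhs_normP (f : rkhs) : [/\ 0 <= rkhs_norm f, bound_by K (rkhs_norm f) f,
  (forall M, 0 <= M -> bound_by K M f -> rkhs_norm f <= M) &
  kdot K f f = rkhs_norm f ^+ 2].
Proof.
have [n [n0 fn nM fE]] := dual_norm_kdot (rkhs_valP f).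
have -> : rkhs_norm f = n by rewrite /rkhs_norm fE sqrCK.
by [].
Qed.

Lemma rkhs_normD (f g : rkhs) : rkhs_norm (f + g) <= rkhs_norm f + rkhs_norm g.
Proof.
have [f0 fb _ _] := rkhs_normP f; have [g0 gb _ _] := rkhs_normP g.
have [_ _ h _] := rkhs_normP (f + g); apply: h; first exact: addr_ge0.
exact: bound_byD.
Qed.

Lemma rkhs_normZ (z : R[i]) (f : rkhs) : rkhs_norm (z *: f) = `|z| * rkhs_norm f.
Proof.
have le (y : R[i]) (g : rkhs) : rkhs_norm (y *: g) <= `|y| * rkhs_norm g.
  have [g0 gb _ _] := rkhs_normP g; have [_ _ h _] := rkhs_normP (y *: g).
  apply: h; first by rewrite mulr_ge0.
  by have := bound_byP y gb (@bound_by0 _ _ _ K 0 (lexx 0)); rewrite !addr0.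
have [->|z0] := eqVneq z 0.
  apply/le_anti; rewrite le normr0 mul0r.
  by have [] := rkhs_normP (0 *: f).
apply/le_anti; rewrite le /= -ler_pdivlMl ?normr_gt0// -normfV.
by apply: le_trans (le _ _); rewrite scalerA mulVf// scale1r.
Qed.

Lemma rkhs_norm0_eq0 (f : rkhs) : rkhs_norm f = 0 -> f = 0.
Proof.
have [_ fb _ _] := rkhs_normP f => f0; rewrite f0 in fb.
exact/val_inj/(bound_by0_eq fb).
Qed.

HB.instance Definition _ :=
  Lmodule_isNormed.Build R[i] rkhs rkhs_normD rkhs_normZ rkhs_norm0_eq0.

Definition rkhs_dot (f g : rkhs) : R[i] := kdot K f g.

Lemma rkhs_dotC f g : rkhs_dot f g = (rkhs_dot g f)^*.
Proof. exact: kdotC (rkhs_valP f) (rkhs_valP g). Qed.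

Lemma rkhs_dotPl z f f' g :
  rkhs_dot (z *: f + f') g = z * rkhs_dot f g + rkhs_dot f' g.
Proof. exact: kdotPl (rkhs_valP f) (rkhs_valP f') (rkhs_valP g). Qed.

Lemma rkhs_dot_bilinear :
  bilinear_for *%R (@Num.conj R[i] \; *%R) rkhs_dot.
Proof.
split=> [g z f f'|f z g g'] /=; first exact: rkhs_dotPl.
by rewrite rkhs_dotC rkhs_dotPl rmorphD rmorphM /= -!rkhs_dotC.
Qed.

HB.instance Definition _ := bilinear_isBilinear.Build R[i] rkhs rkhs R[i]
  _ _ rkhs_dot rkhs_dot_bilinear.

Lemma rkhs_dot_hermitian f g : rkhs_dot f g = (-1) ^+ false * (rkhs_dot g f)^*.
Proof. by rewrite expr0 mul1r -rkhs_dotC. Qed.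

HB.instance Definition _ := isHermitianSesquilinear.Build R[i] rkhs false
  (@Num.conj R[i]) rkhs_dot rkhs_dot_hermitian.

Lemma rkhs_dotE f : rkhs_dot f f = `|f| ^+ 2.
Proof. by have [] := rkhs_normP f. Qed.

Lemma rkhs_dot_gt0 f : f != 0 -> 0 < rkhs_dot f f.
Proof. by move=> f0; rewrite rkhs_dotE exprn_gt0// normr_gt0. Qed.

HB.instance Definition _ := isDotProduct.Build R[i] rkhs rkhs_dot rkhs_dot_gt0.

Lemma rkhs_bound (f : rkhs) c : `|pairing f c| <= `|f| * knorm K c.
Proof. by have [_ + _ _] := rkhs_normP f; apply. Qed.

Lemma rkhs_norm_le (f : rkhs) M : 0 <= M -> bound_by K M f -> `|f| <= M.
Proof. by have [_ _ + _] := rkhs_normP f; apply. Qed.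

(** Pairing f with the single kernel function K(., s) (f s) gives |f s|^2, and the norm
    of that function is at most sqrt(|K s s|) |f s|. *)
Lemma rkhs_eval_bounded s : exists2 M : R[i], 0 < M &
  forall f : rkhs, `|f s| <= M * `|f|.
Proof.
have [M M0 HM] := continuous_bounded ((kernelP K).1 s s).
have M1 : 0 < sqrtC M by rewrite sqrtC_gt0.
exists (sqrtC M) => // f.
have := rkhs_bound f [:: (s, f s)]; rewrite /pairing big_seq1 /= hdotE normrX normr_id.
have -> : forall x : R[i], (x <= sqrtC M * `|f|) = (x <= `|f| * sqrtC M).
  by move=> x; rewrite mulrC.
have k : knorm K [:: (s, f s)] <= sqrtC M * `|f s|.
  rewrite -(ler_pXn2r (ltn0Sn 1)) ?nnegrE ?knorm_ge0 ?mulr_ge0 ?(ltW M1)//.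
  rewrite knormK exprMn sqrtCK /gram /pairing big_seq1 /ksum big_seq1 /=.
  have := hdot_le (K s s (f s)) (f s); rewrite -[X in _ <= X * _](@ger0_norm R[i])//.
  move=> /(le_trans (real_ler_norm _)) h.
  apply: le_trans (h _) _.
    have := gram_ge0 K [:: (s, f s)].
    by rewrite /gram /pairing big_seq1 /ksum big_seq1 => /ger0_real.
  by rewrite normr_id expr2 mulrA ler_wpM2r.
move=> /le_trans-/(_ _ (ler_wpM2l (normr_ge0 _) k)); rewrite mulrA expr2.
have [->|n0] := eqVneq `|f s| 0; first by rewrite mulr_ge0// ltW.
by rewrite ler_pM2r// lt_def n0 normr_ge0.
Qed.

(** Point evaluations are bounded, so a Cauchy filter converges pointwise; it
    converges in norm because the norm is a supremum of functionals that depend on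
    finitely many values each. *)
Lemma rkhs_complete (F : set_system rkhs) : ProperFilter F -> cauchy F -> cvg F.
Proof.
move=> FF /cauchy_ballP cF.
(* Functions whose ball of radius e belongs to the filter play the role of the tail
   of a Cauchy sequence. *)
pose center (e : R[i]) (f : rkhs) := F (ball f e).
have center_le e e' f : e <= e' -> center e f -> center e' f.
  by move=> ee'; apply: filterS; exact: le_ball.
have center_ex e : 0 < e -> exists f, center e f.
  by move=> e0; have [f] := filter_ex (nearP_dep (cF e e0)); exists f.
have center_dist e e' f g : center e f -> center e' g -> `|f - g| <= e + e'.
  move=> Ff Fg; have [h [fh gh]] := filter_ex (filterI Ff Fg).
  move: fh gh; rewrite -!ball_normE /ball_ /= => fh gh.
  rewrite -(subrKA h); apply: le_trans (ler_normD _ _) _.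
  by rewrite lerD// ltW// distrC.
have pointwise s : exists l : H, forall d : R[i], 0 < d -> exists e : R[i],
    [/\ 0 < e, e <= d & forall f, center e f -> `|l - f s| <= d].
  have [M M0 HM] := rkhs_eval_bounded s.
  have [|||l Hl] := @nested_complete _ H (fun e v => exists2 f, center e f & v = f s).
  - by move=> e /center_ex[f Hf]; exists (f s), f.
  - by move=> e e' _ ee' [f Hf ->]; exists f => //; exact: center_le Hf.
  - move=> d d0; have [e [e0 _ eM]] := exists_small d0 (mulr_gt0 (ltr0n _ 2) M0).
    exists e => // _ _ [f Hf ->] [g Hg ->].
    apply: le_trans (HM (f - g)) (le_trans _ eM).
    rewrite mulrC [2 * M]mulrC mulrA [e * M]mulrC -mulrA [M * _]mulrC.
    rewrite ler_wpM2r ?(ltW M0)//.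
    by apply: le_trans (center_dist _ _ _ _ Hf Hg) _; rewrite mulr_natr mulr2n.
  exists l => d d0; have [e [e0 ed He]] := Hl _ d0; exists e; split=> // f Hf.
  by apply: He; exists f.
have [l Hl] := choice pointwise.
have pair_l c (d : R[i]) : 0 < d -> exists e : R[i], [/\ 0 < e, e <= d &
    forall f, center e f -> `|pairing (l - (f : T -> H)) c| <= d].
  elim: c d => [|[s v] c IH] d d0.
    by exists d; split=> // f _; rewrite /pairing big_nil normr0 ltW.
  have d2 : 0 < d / 2 by rewrite divr_gt0.
  have v1 : 0 < `|v| + 1 by rewrite ltr_wpDl.
  have [x [x0 _ xX]] := exists_small d2 v1.
  have [e [e0 ex He]] := Hl s x x0.
  have [e' [e'0 e'd He']] := IH _ d2.
  have d2d : d / 2 <= d by rewrite ler_pdivrMr// ler_pMr// ler1n.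
  have [y [y0 ye ye']] := exists_le_pos e0 e'0.
  exists y; split=> // [|f Hf]; first exact: le_trans ye' (le_trans e'd d2d).
  rewrite /pairing big_cons [d]splitr; apply: le_trans (ler_normD _ _) (lerD _ _).
    apply: le_trans (hdot_le _ _) _; apply: le_trans xX.
    apply: ler_pM => //; last by rewrite lerDl.
    by apply: He; exact: center_le Hf.
  by apply: He'; exact: center_le Hf.
have l_bound (e : R[i]) (f : rkhs) : 0 < e -> center e f ->
    bound_by K (e + e) (l - (f : T -> H)).
  move=> e0 Hf c; apply/ler_addgt0Pl => d d0.
  have [e' [e'0 e'd He']] := pair_l c d d0.
  have [y [y0 ye ye']] := exists_le_pos e0 e'0.
  have [g Hg] := center_ex y y0.
  rewrite -(subrKA (g : T -> H)) /=.
  have -> : l - (g : T -> H) + ((g : T -> H) - (f : T -> H)) =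
     1 *: (l - (g : T -> H)) + (g - f : rkhs) by rewrite scale1r.
  rewrite pairingP mul1r; apply: le_trans (ler_normD _ _) (lerD _ _).
    by apply: He'; exact: center_le Hg.
  apply: le_trans (rkhs_bound _ _) _; rewrite ler_wpM2r ?knorm_ge0//.
  exact: center_dist (center_le _ _ _ ye Hg) Hf.
have lP : l \in rkhs_pred K.
  apply/rkhs_predP => e e0; have e4 : 0 < e / 2 / 2 by rewrite !divr_gt0.
  have e2 : 0 < e / 2 by rewrite divr_gt0.
  have [f Hf] := center_ex _ e4.
  have /rkhs_predP/(_ _ e2)[c fc] := rkhs_valP f.
  exists c; rewrite -(subrKA (f : T -> H)) [e]splitr; apply: bound_byD => //.
  by rewrite [e / 2]splitr; exact: l_bound.
pose L := Rkhs lP.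
suff /cvgP : F --> L by [].
apply/fcvgrPdist_lt => e e0; have e4 : 0 < e / 4 by rewrite divr_gt0.
have [f Hf] := center_ex _ e4.
apply: filterS (Hf) => g; rewrite -ball_normE /ball_ /= => fg.
rewrite -(subrKA f); apply: le_lt_trans (ler_normD _ _) _.
have -> : e = (e / 4 + e / 4) + (e / 4 + e / 4) by field.
apply: ler_ltD; last by apply: lt_le_trans fg _; rewrite lerDl ltW.
apply: rkhs_norm_le; first by rewrite addr_ge0// ltW.
have -> : rkhs_val (L - f) = l - (f : T -> H) by rewrite -[l]/(val L) -raddfB.
exact: l_bound _ _ e4 Hf.
Qed.

HB.instance Definition _ := Uniform_isComplete.Build rkhs rkhs_complete.

HB.instance Definition _ :=
  CompleteNormedModule_isHilbert.Build R rkhs rkhs_dotE.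

End Rkhs.

Section MooreAronszajn.
Variables (R : realType) (H : hilbertType R) (T : Type).

(** The Moore-Aronszajn theorem for operator-valued kernels. *)
Theorem rkhs_exists (K : T -> T -> {linear H -> H}) : pos_def_kernel K ->
  exists (F : hilbertType R) (ev : T -> {linear F -> H}), is_rkhs K ev.
Proof.
move=> hK; pose K' := PdKernel hK.
have /choice[ev evE] : forall s, exists e : {linear rkhs K' -> H},
    forall f, e f = rkhs_val f s.
  by move=> s; apply: linear_bundle.
pose ks t v : rkhs K' := Rkhs (rkhs_pred_ksum K' [:: (t, v)]).
have /choice[adj adjE] : forall t, exists e : {linear H -> rkhs K'},
    forall v, e v = ks t v.
  move=> t; apply: linear_bundle => z u v; apply/val_inj/funext => s.
  rewrite -[RHS]/(z *: ks t u s + ks t v s) /ks /= /ksum !big_seq1.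
  exact: linearP.
exists (rkhs K' : hilbertType R), ev; split.
- by move=> f g fg; apply/val_inj/funext => s; rewrite -[LHS]evE fg evE.
- move=> s; have [M M0 HM] := rkhs_eval_bounded K' s.
  by apply: (lipschitz_continuous (ltW M0)) => f; rewrite evE.
exists adj => [t f v|s t v].
  rewrite adjE evE; have := kdot_ksum [:: (t, v)] (rkhs_valP f).
  by rewrite /pairing big_seq1.
by rewrite adjE evE /= /ksum big_seq1.
Qed.

End MooreAronszajn.

(** * Positive definiteness of the semigroup kernel *)

Section SemigroupKernel.
Variables (R : realType) (H : hilbertType R) (C : R -> {linear H -> H}).
Hypothesis hC : selfadjoint_contraction_semigroup C.
Implicit Types (p q : R * H) (c : seq (R * H)).

Let Cform c := \sum_(p <- c) \sum_(q <- c) '[C `|p.1 - q.1| q.2, p.2].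

(** The function sum_q K(., q.1) q.2 evaluated at s, when s lies to the left of all the
    points of c. *)
Let Ctail (s : R) c := \sum_(q <- c) C (q.1 - s) q.2.

Lemma Ctail_shift r s c : r <= s -> all (fun q => s <= q.1) c ->
  Ctail r c = C (s - r) (Ctail s c).
Proof.
move=> rs /allP sc; rewrite /Ctail linear_sum; apply: eq_big_seq => q qc.
rewrite -(semigroupD hC) ?subr_ge0//; last exact: sc.
by rewrite [X in _ = C X _]addrC subrKA.
Qed.

Lemma Cform_cons p c : all (fun q => p.1 <= q.1) c ->
  Cform (p :: c) = '[p.2 + Ctail p.1 c, p.2 + Ctail p.1 c]
    - '[Ctail p.1 c, Ctail p.1 c] + Cform c.
Proof.
move=> /allP pc; rewrite /Cform big_cons big_cons subrr normr0 (semigroup0 hC).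
have -> : \sum_(q <- c) '[C `|p.1 - q.1| q.2, p.2] = '[Ctail p.1 c, p.2].
  rewrite /Ctail hdot_suml; apply: eq_big_seq => q /pc pq.
  by rewrite distrC ger0_norm// subr_ge0.
have -> : \sum_(r <- c) \sum_(q <- p :: c) '[C `|r.1 - q.1| q.2, r.2] =
    '[p.2, Ctail p.1 c] + \sum_(r <- c) \sum_(q <- c) '[C `|r.1 - q.1| q.2, r.2].
  rewrite /Ctail hdot_sumr -big_split; apply: eq_big_seq => q /pc pq /=.
  rewrite big_cons ger0_norm ?subr_ge0//; congr (_ + _).
  by apply: (semigroup_selfadjoint hC); rewrite subr_ge0.
by rewrite hdotDl !hdotDr; ring.
Qed.

(** The points are added from right to left.  A new leftmost point replaces the
    tail vector w by p + C w, and the form grows by |p + C w|^2 - |C w|^2, at least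
    the growth of the squared norm of the tail since C is a contraction. *)
Lemma Cform_ge p c : path (fun p q => p.1 <= q.1) p c ->
  `|Ctail p.1 (p :: c)| ^+ 2 <= Cform (p :: c).
Proof.
have tr : transitive (fun p q : R * H => p.1 <= q.1).
  by move=> x y z; exact: le_trans.
elim: c p => [|r c IH] p pc.
  rewrite /Ctail /Cform !big_seq1 subrr normr0 !(semigroup0 hC) hdotE.
  by [].
have pall := order_path_min tr pc.
have /= /andP[pr rc] := pc.
rewrite Cform_cons// /Ctail big_cons subrr (semigroup0 hC) -hdotE -addrA lerDl.
rewrite -/(Ctail _ _) addrC subr_ge0; apply: le_trans (IH _ rc).
have rall : all (fun q => r.1 <= q.1) (r :: c).
  by rewrite /= lexx; exact: order_path_min rc.
rewrite (Ctail_shift pr rall) hdotE ler_pXn2r ?nnegrE//.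
by apply: (semigroup_contraction hC); rewrite subr_ge0.
Qed.

(** The form does not depend on the order of the points, so they may be sorted. *)
Theorem semigroup_pos_def : pos_def_kernel (fun s t : R => C `|s - t|).
Proof.
split=> [s t|n s v].
  apply: (@lipschitz_continuous _ _ _ _ 1) => // u.
  by rewrite mul1r; exact: semigroup_contraction.
pose c := [seq (s i, v i) | i <- enum 'I_n].
have -> : \sum_(j < n) \sum_(k < n) '[C `|s j - s k| (v k), v j] = Cform c.
  rewrite /Cform /c big_map big_enum; apply: eq_bigr => j _.
  by rewrite big_map big_enum.
pose c' := sort (fun p q : R * H => p.1 <= q.1) c.
have cc' : perm_eq c c' by rewrite perm_sym; apply/permPl; exact: perm_sort.
have -> : Cform c = Cform c'.
  rewrite /Cform (perm_big c')//; apply: eq_bigr => p _.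
  by rewrite (perm_big c').
have : sorted (fun p q : R * H => p.1 <= q.1) c'.
  by apply: sort_sorted => p q; exact: le_total.
case: c' {cc'} => [|p d] /= pd; first by rewrite /Cform big_nil.
by apply: le_trans (Cform_ge pd); rewrite exprn_ge0.
Qed.

Lemma semigroup_cvg0 v (e : R[i]) : 0 < e ->
  exists2 d : R, 0 < d & forall r : R, `|r| < d -> `|C `|r| v - v| <= e.
Proof.
move=> e0; have /subspace_continuousP/(_ 0) := @semigroup_continuous _ _ _ hC v.
rewrite /= in_itv /= lexx => /(_ isT)/cvgrPdist_le/(_ e e0).
rewrite near_withinE => /nbhs_ballP[d /= d0 Hd]; exists d => // r rd.
have : ball (0 : R) d `|r|.
  by rewrite -ball_normE /ball_ /= sub0r normrN normr_id.
move=> /Hd; rewrite /= in_itv /= normr_ge0 /from_subspace (semigroup0 hC) distrC.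
exact.
Qed.

End SemigroupKernel.

(** * Symmetries of a reproducing kernel Hilbert space *)

Section KernelFunctions.
Variables (R : realType) (H : hilbertType R) (T : Type) (K : T -> T -> {linear H -> H}).
Variables (F : hilbertType R) (ev : T -> {linear F -> H}) (k : T -> {linear H -> F}).
Hypotheses (hF : is_rkhs K ev) (ev_k : forall t, adjoint (ev t) (k t)).
Hypothesis kE : forall s t v, ev s (k t v) = K s t v.

Lemma kernel_gram s t v w : '[k t v, k s w] = '[K s t v, w].
Proof. by rewrite -ev_k kE. Qed.

(** A vector orthogonal to the kernel functions vanishes at every point. *)
Lemma kernel_total : total_family (fun p : T * H => k p.1 p.2).
Proof.
apply: total_orthogonal => f f0; apply: (rkhs_inj hF) => s.
by rewrite linear0; apply: hdot_eq0; rewrite ev_k; exact: f0 (s, _).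
Qed.

(** A symmetry of the kernel permutes the kernel functions without changing
    their Gram matrix. *)
Lemma kernel_symmetry (sg ta : T -> T) : cancel sg ta -> cancel ta sg ->
  (forall s t v, K (sg s) (sg t) v = K s t v) ->
  exists W : {linear F -> F}, unitary W /\ forall f s, ev s (W f) = ev (ta s) f.
Proof.
move=> sgK taK Ksg.
have [|||W [uW Wk]] := @gram_unitary _ _ _ _ (fun p : T * H => k p.1 p.2)
    (fun p => k (sg p.1) p.2).
- by move=> [t v] [s w] /=; rewrite !kernel_gram Ksg.
- exact: kernel_total.
- apply: total_orthogonal => f f0; apply: (rkhs_inj hF) => s.
  rewrite linear0; apply: hdot_eq0; rewrite ev_k -(taK s).
  exact: f0 (ta s, _).
exists W; split=> // f s; apply: hdot_injl => v.
by rewrite !ev_k -[in LHS](taK s) -(Wk (ta s, v)) uW.1.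
Qed.

End KernelFunctions.

(** * The dilation space of a semigroup *)

Section Dilation.
Variables (R : realType) (H : hilbertType R) (C : R -> {linear H -> H}).
Hypothesis hC : selfadjoint_contraction_semigroup C.
Let K : R -> R -> {linear H -> H} := fun s t => C `|s - t|.
Variables (F : hilbertType R) (ev : R -> {linear F -> H}) (k : R -> {linear H -> F}).
Hypotheses (hF : is_rkhs K ev) (ev_k : forall t, adjoint (ev t) (k t)).
Hypothesis kE : forall s t v, ev s (k t v) = K s t v.

Let gram := kernel_gram ev_k kE.

Lemma kernel_dist s t v :
  `|k s v - k t v| ^+ 2 = '[v - C `|s - t| v, v] *+ 2.
Proof.
rewrite -hdotE !hdotBl !hdotBr !gram /K !subrr normr0 (semigroup0 hC).
by rewrite (distrC t s); ring.
Qed.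

Lemma kernel_cvg v (e : R[i]) : 0 < e ->
  exists2 d : R, 0 < d & forall s t, `|s - t| < d -> `|k s v - k t v| <= e.
Proof.
move=> e0; have v1 : 0 < `|v| + 1 by rewrite ltr_wpDl.
have e1 : 0 < e ^+ 2 / 2 / (`|v| + 1) by rewrite !divr_gt0 ?exprn_gt0.
have [d d0 Hd] := semigroup_cvg0 hC v e1; exists d => // s t /Hd h.
rewrite -(ler_pXn2r (ltn0Sn 1)) ?nnegrE ?(ltW e0)//.
have -> : `|k s v - k t v| ^+ 2 = `|'[v - C `|s - t| v, v]| *+ 2.
  by rewrite -normrMn -kernel_dist normrX normr_id.
rewrite -mulr_natr -ler_pdivlMr//; apply: le_trans (hdot_le _ _) _.
rewrite distrC; rewrite ler_pdivlMr// in h; apply: le_trans h.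
by rewrite ler_wpM2l// lerDl.
Qed.

Definition pos_gens : set F :=
  [set f | exists (t : R) v, 0 < t /\ forall s, ev s f = C `|s + t| v].

Lemma pos_gensP f : pos_gens f <-> exists (t : R) v, 0 < t /\ f = k (- t) v.
Proof.
split=> [[t [v [t0 fE]]]|[t [v [t0 ->]]]]; exists t, v; split=> //.
  by apply: (rkhs_inj hF) => s; rewrite fE kE /K opprK.
by move=> s; rewrite kE /K opprK.
Qed.

Definition pos_space : set F := closure (lspan pos_gens).

Lemma pos_space_min (B : set F) : closed_subspace B ->
  (forall t v, 0 < t -> B (k (- t) v)) -> pos_space `<=` B.
Proof.
by move=> cB kB; apply: closed_span_min => // _ /pos_gensP[t [v [t0 ->]]]; exact: kB.
Qed.

Lemma pos_space_k t v : 0 < t -> pos_space (k (- t) v).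
Proof. by move=> t0; apply: sub_closed_span; apply/pos_gensP; exists t, v. Qed.

(** The kernel functions at zero are limits of those at -t as t decreases to zero. *)
Lemma pos_space_k0 v : pos_space (k 0 v).
Proof.
apply/closureP => e e0; have e2 : 0 < e / 2 by rewrite divr_gt0.
have [d d0 Hd] := kernel_cvg v e2.
have d2 : 0 < d / 2 by rewrite divr_gt0.
exists (k (- (d / 2)) v).
  by apply: sub_lspan; apply/pos_gensP; exists (d / 2), v.
apply: le_lt_trans (Hd _ _ _) _; last by rewrite ltr_pdivrMr// ltr_pMr// ltr1n.
by rewrite sub0r opprK gtr0_norm// ltr_pdivrMr// ltr_pMr// ltr1n.
Qed.

(** On the positive subspace, evaluation at zero intertwines translations and the
    semigroup; it suffices to check this on the kernel functions. *)
Lemma ev_pos_space t f : 0 <= t -> pos_space f -> ev t f = C t (ev 0 f).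
Proof.
move=> t0 Pf; apply: hdot_injl => w; apply/subr0_eq.
rewrite (semigroup_selfadjoint hC)// !ev_k -hdotBr.
apply: pos_space_min (closed_subspace_orth _) _ _ Pf => s v s0 /=.
rewrite hdotBr -!ev_k !kE /K sub0r opprK (gtr0_norm s0).
rewrite ger0_norm ?addr_ge0 ?(ltW s0)//.
by rewrite (semigroupD hC) ?(ltW s0)// (semigroup_selfadjoint hC)// subrr.
Qed.

Variable th : {linear F -> F}.
Hypotheses (th_iso : isometry hdot hdot th)
  (thE : forall f s, ev s (th f) = ev (- s) f).

Lemma theta_involutive f : th (th f) = f.
Proof. by apply: (rkhs_inj hF) => s; rewrite !thE opprK. Qed.

Lemma theta_sym f g : '[th f, g] = '[f, th g].
Proof. by rewrite -{1}(theta_involutive g) th_iso. Qed.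

Lemma theta_kernel t v : th (k t v) = k (- t) v.
Proof.
apply: (rkhs_inj hF) => s; rewrite thE !kE /K; congr (C _ v).
by rewrite opprK -opprD normrN.
Qed.

(** Hence the reflected form is that of the evaluation at zero, which is therefore
    the canonical map to the quotient Hilbert space. *)
Lemma reflection_form f g : pos_space f -> pos_space g ->
  '[th f, g] = '[ev 0 f, ev 0 g].
Proof.
move=> Pf Pg.
have ortho h : '[f, th h - k 0 (ev 0 h)] = '[th f, h] - '[ev 0 f, ev 0 h].
  by rewrite hdotBr -ev_k theta_sym.
have gens t v : 0 < t -> '[th f, k (- t) v] = '[ev 0 f, ev 0 (k (- t) v)].
  move=> t0; rewrite theta_sym theta_kernel opprK -ev_k ev_pos_space ?(ltW t0)//.
  by rewrite (semigroup_selfadjoint hC) ?(ltW t0)// kE /K sub0r opprK gtr0_norm.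
apply/subr0_eq; rewrite [X in X - _]hdotC [X in _ - X]hdotC -rmorphB.
suff -> : '[g, th f] - '[ev 0 g, ev 0 f] = 0 by rewrite rmorph0.
rewrite [X in _ - X]ev_k -hdotBr.
apply: pos_space_min (closed_subspace_orth _) _ _ Pg => t v t0 /=.
rewrite hdotBr -ev_k hdotC [X in _ - X]hdotC -rmorphB.
by rewrite gens// subrr rmorph0.
Qed.

Variable U : R -> {linear F -> F}.
Hypotheses (U_unitary : forall t, unitary (U t))
  (UE : forall t f s, ev s (U t f) = ev (s + t) f).

Lemma translate_kernel r t v : U r (k t v) = k (t - r) v.
Proof.
apply: (rkhs_inj hF) => s; rewrite UE !kE /K; congr (C _ v).
by rewrite opprB addrA addrAC.
Qed.

Lemma translate_pos_space t f : 0 <= t -> pos_space f -> pos_space (U t f).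
Proof.
move=> t0; apply: (@pos_space_min (U t @^-1` pos_space)).
  apply: closed_subspace_preimage; last exact: closed_subspace_span.
  by apply: isometry_continuous; case: (U_unitary t).
move=> s v s0; rewrite /preimage /= translate_kernel -opprD; apply: pos_space_k.
by rewrite ltr_wpDr.
Qed.

(** Strong continuity at zero: the vectors with continuous orbit form a closed
    subspace, since the U t are isometries, and it contains the kernel functions. *)
Lemma dilation_group_axioms : unitary_group U.
Proof.
have U_iso t f : `|U t f| = `|f| by apply: isometry_norm; case: (U_unitary t).
have U0 f : U 0 f = f by apply: (rkhs_inj hF) => s; rewrite UE addr0.
have UD s t f : U (s + t) f = U s (U t f).
  by apply: (rkhs_inj hF) => r; rewrite !UE addrA.
split=> // f t.
have cvg0 : U r f @[r --> (0 : R)] --> f.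
  pose A := [set f : F | U r f @[r --> (0 : R)] --> f].
  suff : closure (lspan (range (fun p : R * H => k p.1 p.2))) `<=` A.
    by apply; exact: (kernel_total hF ev_k).
  apply: closed_span_min => [|_ [[s v] _ <-] /=]; last first.
    apply/cvgrPdist_le => e e0; have [d d0 Hd] := kernel_cvg v e0.
    apply/nbhs_ballP; exists d => // r rd /=; rewrite translate_kernel; apply: Hd.
    by move: rd; rewrite /ball_ /= subKr sub0r normrN.
  split.
    apply/linear_subspaceP; split=> [|z u v Au Av].
      rewrite /A /= (_ : (fun r => U r 0) = fun=> 0); first exact: cvg_cst.
      by apply/funext => r; rewrite linear0.
    rewrite /A /= (_ : (fun r => _) = fun r => z *: U r u + U r v); last first.
      by apply/funext => r; rewrite linearP.
    by apply: cvgD => //; apply: cvgZr.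
  move=> u /closureP cu /=; apply/cvgrPdist_le => e e0.
  have e3 : 0 < e / 3 by rewrite divr_gt0.
  have [u' /cvgrPdist_le/(_ _ e3) Au' uu'] := cu _ e3.
  near=> r.
  rewrite -(subrKA u') -[u' - U r u](subrKA (U r u')).
  have -> : e = e / 3 + (e / 3 + e / 3) by field.
  apply: le_trans (ler_normD _ _) (lerD (ltW uu') _).
  apply: le_trans (ler_normD _ _) (lerD _ _); first by near: r.
  by rewrite -linearB U_iso distrC ltW.
apply/cvgrPdist_le => e e0; move/cvgrPdist_le: cvg0 => /(_ e e0).
move=> /nbhs_ballP[d /= d0 Hd]; apply/nbhs_ballP; exists d => // s ts /=.
have -> : U s f = U t (U (s - t) f) by rewrite -UD addrC subrK.
rewrite -linearB U_iso; apply: Hd.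
by rewrite -ball_normE /ball_ /= sub0r normrN distrC.
Unshelve. all: by end_near. Qed.

End Dilation.

(** * Existence of the realization *)

Section Existence.
Variables (R : realType) (H : hilbertType R) (C : R -> {linear H -> H}).
Hypothesis hC : selfadjoint_contraction_semigroup C.
Let phi : R -> {linear H -> H} := fun t => C `|t|.

Lemma dilation_exists : exists (D : rpHilbert R) (V : R -> {linear D -> D})
  (ev : R -> {linear D -> H}), rp_unitary_group V /\ dilation phi V ev.
Proof.
have [F [ev hF]] := rkhs_exists (semigroup_pos_def hC).
have [k ev_k kE] := rkhs_kernel hF.
have [|th [uth thE]] := kernel_symmetry hF ev_k kE (@opprK R) (@opprK R).
  by move=> s t v; rewrite -opprD normrN.
have /choice[U UP] : forall t : R, exists U : {linear F -> F},
    unitary U /\ forall f s, ev s (U f) = ev (s + t) f.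
  move=> t; apply: (kernel_symmetry hF ev_k kE (sg := fun s => s - t)).
  - by move=> s; rewrite subrK.
  - by move=> s; rewrite addrK.
  - by move=> s r v; rewrite opprB addrA subrK.
have uU t : unitary (U t) by case: (UP t).
have UE t f s : ev s (U t f) = ev (s + t) f by case: (UP t).
have thK : involutive th.
  by move=> f; apply: (rkhs_inj hF) => s; rewrite !thE opprK.
have [sP cP] := closed_subspace_span (pos_gens C ev).
have D0 v : pos_space C ev v -> 0 <= '[th v, v].
  move=> Pv; rewrite (reflection_form hC hF ev_k kE uth.1 thE Pv Pv).
  by rewrite hdotE exprn_ge0.
have gU := dilation_group_axioms hC hF ev_k kE uU UE.
exists (RPHilbert uth thK cP sP D0), U, ev; split.
  split=> // [t t0 _ [f Pf <-]|t f].
    exact: (translate_pos_space hF kE uU UE (ltW t0)).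
  by apply: (rkhs_inj hF) => s; rewrite /= thE UE thE UE opprD opprK.
split=> // f t.
have -> : (fun s => ev s f) = ev 0 \o (fun s => U s f).
  by apply/funext => s; rewrite /= UE add0r.
apply: continuous_comp; first exact: group_continuous gU _ _.
exact: rkhs_continuous hF _ _.
Qed.

(** For the realization by dilation the completion is H itself, and the canonical
    map is evaluation at zero. *)
Lemma dilation_realization (D : rpHilbert R) (V : R -> {linear D -> D})
    (ev : R -> {linear D -> H}) : rp_unitary_group V -> dilation phi V ev ->
  [/\ euclidean_realization C V (ev 0), unitary_on_fixed (ev 0) &
    cyclic_for V (rp_fixed D)].
Proof.
move=> uV dV; have hF := dilation_rkhs dV; have [k ev_k kE] := rkhs_kernel hF.
have VE := dilation_group dV; have thE := dilation_theta dV.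
have th_iso := (rp_theta_unitary D).1.
have posE : rp_pos D = pos_space C ev := dilation_pos dV.
have form f g : rp_pos D f -> rp_pos D g ->
    '[rp_theta D f, g] = '[ev 0 f, ev 0 g].
  by rewrite posE; exact: (reflection_form hC hF ev_k kE th_iso thE).
have k0 v : rp_fixed D (k 0 v).
  split; first by rewrite posE; exact: (pos_space_k0 hC hF ev_k kE).
  by rewrite (theta_kernel hF kE thE) oppr0.
have evk0 v : ev 0 (k 0 v) = v by rewrite kE /phi subrr normr0 (semigroup0 hC).
split.
- split=> //.
  + split=> [a v w _ _|v Pv|].
    * exact: linearP.
    * by rewrite form// hdotE sqrCK.
    * move=> B [v Bv] _; exists v; split=> //; exists (k 0 v) => //.
      by case: (k0 v).
  + exists C.
      split=> // t v t0 Pv; rewrite VE add0r -(ev_pos_space hC hF ev_k kE t0)//.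
      by rewrite -posE.
    by exists (idfun : {linear H -> H}).
- split=> [f g|]; last split=> //.
  + by rewrite !inE => -[Pf fE] [Pg gE]; rewrite -form// fE.
  + move=> f g; rewrite !inE => -[Pf fE] [Pg gE] fg; apply/subr0_eq/hdot_eq0.
    have Pfg : rp_pos D (f - g) by exact: subspaceB (rp_pos_subspace D) Pf Pg.
    have fgE : rp_theta D (f - g) = f - g by rewrite linearB fE gE.
    by rewrite -[X in hdot X _]fgE form// linearB fg subrr hdot0l.
  + by move=> v _; exists (k 0 v).
- apply/dense_closed_span => f.
  have : closure (lspan (range (fun p : R * H => k p.1 p.2))) f.
    exact: (kernel_total hF ev_k).
  apply: closureS f; apply: lspan_min; first exact: subspace_lspan.
  move=> _ [[t v] _ <-]; apply: sub_lspan; exists (- t) => //=.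
  by exists (k 0 v) => //; rewrite (translate_kernel hF kE VE) sub0r opprK.
Qed.

End Existence.

(** * Uniqueness of the realization *)

Section Uniqueness.
Variables (R : realType) (H : hilbertType R) (C : R -> {linear H -> H}).
Hypothesis hC : selfadjoint_contraction_semigroup C.
Let phi : R -> {linear H -> H} := fun t => C `|t|.

Variables (X : rpHilbert R) (U : R -> {linear X -> X}) (Y : hilbertType R) (q : X -> Y).
Hypotheses (hU : rp_unitary_group U) (hq : rp_completion q).

Let th := rp_theta X.

Lemma rp_theta_sym x y : '[th x, y] = '[x, th y].
Proof. by rewrite -{1}(rp_theta_involutive y) (rp_theta_unitary X).1. Qed.

(** Polarization of the norm identity that defines the completion. *)
Lemma completion_form x y : rp_pos X x -> rp_pos X y -> '[q x, q y] = '[th x, y].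
Proof.
move=> Px Py; apply/subr0_eq; move: x y Px Py.
apply: polarization => [a u v|a u v w Pu Pv Pw|a u v w Pu Pv Pw|u Pu].
- exact: subspaceP (rp_pos_subspace X).
- by rewrite (rp_completion_linear hq)// linearP !hdotDl !hdotZl; ring.
- by rewrite (rp_completion_linear hq)// !hdotDr !hdotZr; ring.
- by rewrite hdotE (rp_completion_norm hq)// sqrtCK subrr.
Qed.

Variables (S : R -> {linear Y -> Y}) (W0 : {linear Y -> H}).
Hypotheses (hS : induced_semigroup U q S) (uW0 : unitary W0)
  (W0S : forall (t : R) v, 0 <= t -> W0 (S t v) = C t (W0 v)).
Hypothesis q_fixed : unitary_on_fixed q.
Variable j : H -> X.
Hypothesis j_fixed : forall v, rp_fixed X (j v).
Hypothesis jE : forall v, W0 (q (j v)) = v.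

Let gU := rp_group_unitary hU.
Let U_iso t u v : '[U t u, U t v] = '[u, v].
Proof. exact: isometry_hdot (group_unitary gU t).1 _ _. Qed.

Let W0_inj : injective W0.
Proof. by case: uW0 => _ /bij_inj. Qed.

Lemma fixed_j x : rp_fixed X x -> x = j (W0 (q x)).
Proof.
move=> xf; have [_ [_ q_inj _]] := q_fixed.
by apply: q_inj; rewrite ?inE//; apply: W0_inj; rewrite jE.
Qed.

Lemma group_pos t x : 0 <= t -> rp_pos X x -> rp_pos X (U t x).
Proof.
rewrite le_eqVlt => /predU1P[<-|t0] Px; first by rewrite (group0 gU).
by apply: (rp_group_pos hU t0); exists x.
Qed.

(** Since j w is fixed by theta, the inner product equals the reflected one, which is
    computed in the completion. *)
Lemma fixed_correlation r v w : 0 <= r -> '[U r (j v), j w] = '[C r v, w].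
Proof.
move=> r0; have [Pv _] := j_fixed v; have [Pw thw] := j_fixed w.
rewrite -[in LHS]thw -/th -rp_theta_sym -completion_form//; last exact: group_pos.
by rewrite -hS.2// -uW0.1 W0S// !jE.
Qed.

Let a (p : R * H) : X := U (- p.1) (j p.2).

Lemma fixed_gram s t v w : '[a (t, v), a (s, w)] = '[C `|s - t| v, w].
Proof.
rewrite /a /=; have [ts|st] := leP t s.
  rewrite -(U_iso s) -!(groupD gU) subrr (group0 gU) fixed_correlation ?subr_ge0//.
  by rewrite ger0_norm// subr_ge0.
rewrite -(U_iso t) -!(groupD gU) subrr (group0 gU) hdotC.
rewrite fixed_correlation ?subr_ge0 ?ltW//.
rewrite -hdotC distrC gtr0_norm ?subr_gt0//.
by rewrite (semigroup_selfadjoint hC)// subr_ge0 ltW.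
Qed.

Lemma fixed_total : cyclic_for U (rp_fixed X) -> total_family a.
Proof.
move=> /dense_closed_span cU x; have := cU x; apply: closureS.
apply: lspan_min; first exact: subspace_lspan.
move=> _ [t _ [y yf <-]]; apply: sub_lspan; exists (- t, W0 (q y)) => //.
by rewrite /a /= opprK -fixed_j.
Qed.

Lemma theta_translate t v : th (U t (j v)) = U (- t) (j v).
Proof. by have [_ {1}<-] := j_fixed v; exact: (rp_group_theta hU). Qed.

Let M : set X := closure (lspan [set x | exists (t : R) v, 0 < t /\ x = U t (j v)]).

Lemma closed_j v : M (j v).
Proof.
apply/closureP => e e0.
have /cvgrPdist_lt/(_ e e0)/nbhs_ballP[d /= d0 Hd] :=
  @group_continuous _ _ _ gU (j v) 0.
have d2 : 0 < d / 2 by rewrite divr_gt0.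
exists (U (d / 2) (j v)); first by apply: sub_lspan; exists (d / 2), v.
have : ball (0 : R) d (d / 2).
  rewrite -ball_normE /ball_ /= sub0r normrN gtr0_norm//.
  by rewrite ltr_pdivrMr// ltr_pMr// ltr1n.
by move=> /Hd /=; rewrite (group0 gU).
Qed.

(** The Markov property: a vector of the positive subspace orthogonal to the future
    of the fixed vectors is orthogonal to the fixed vectors, hence q kills it,
    hence it is orthogonal to the reflected future as well. *)
Lemma pos_closed_span : total_family a -> rp_pos X = M.
Proof.
move=> ta; have cP : closed_subspace (rp_pos X).
  by split; [exact: rp_pos_subspace|exact: rp_pos_closed].
have jP v : rp_pos X (j v) by case: (j_fixed v).
have MP : M `<=` rp_pos X.
  by apply: closed_span_min => // _ [t [v [t0 ->]]]; exact: group_pos (ltW t0) _.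
apply/seteqP; split=> // x Px.
have [m Mm xm] := projection x (closed_subspace_span _ : closed_subspace M).
set y := x - m in xm.
have Py : rp_pos X y by apply: subspaceB (rp_pos_subspace X) Px _; exact: MP.
have ortho_j v : '[y, j v] = 0 by apply: xm; exact: closed_j.
have qy : q y = 0.
  have qyE : q y = q (j (W0 (q y))) by apply: W0_inj; rewrite jE.
  apply: hdot_eq0; rewrite {2}qyE completion_form// rp_theta_sym.
  by rewrite (j_fixed _).2.
have y0 : y = 0.
  apply: hdot_eq0.
  have : closure (lspan (range a)) `<=` [set z | '[z, y] = 0].
    apply: closed_span_min (closed_subspace_orth y) _ => _ [[t v] _ <-] /=.
    rewrite hdotC /a /=; have [t0|t0|->] := ltgtP t 0; last first.
    - by rewrite oppr0 (group0 gU) ortho_j rmorph0.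
    - rewrite -theta_translate -rp_theta_sym -completion_form//.
        by rewrite qy hdot0l rmorph0.
      exact: group_pos (ltW t0) _.
    - rewrite xm ?rmorph0//; apply: sub_closed_span.
      by exists (- t), v; rewrite oppr_gt0.
  by apply; exact: ta.
by rewrite -[x](subrK m) -/y y0 add0r.
Qed.

Hypothesis cU : cyclic_for U (rp_fixed X).

(** For the unitary W with W (U (- t) (j v)) = k t v, the value of W x at s is
    determined by the inner products of x with the a (s, v); the intertwining
    relations follow because the group and the involution act on these vectors as
    they do on points. *)
Lemma realization_unique (D : rpHilbert R) (V : R -> {linear D -> D})
    (ev : R -> {linear D -> H}) : dilation phi V ev -> realization_equiv U V.
Proof.
move=> dV; have hF := dilation_rkhs dV; have [k ev_k kE] := rkhs_kernel hF.
have VE := dilation_group dV; have thE := dilation_theta dV.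
have posE : rp_pos D = pos_space C ev := dilation_pos dV.
have ta := fixed_total cU; have tk := kernel_total hF ev_k.
pose b (p : R * H) := k p.1 p.2.
have ab p p' : '[a p, a p'] = '[b p, b p'].
  by case: p p' => [t v] [s w]; rewrite fixed_gram (kernel_gram ev_k kE).
have [W [uW Wa]] := gram_unitary ab ta tk.
have [W' [uW' W'b]] := gram_unitary (fun p p' => esym (ab p p')) tk ta.
have evW s x v : '[ev s (W x), v] = '[x, a (s, v)].
  by rewrite ev_k -[k s v]/(b (s, v)) -Wa isometry_hdot//; case: uW.
have cW := isometry_continuous uW.1; have cW' := isometry_continuous uW'.1.
have WK f : W (W' f) = f.
  have cWW' : continuous (W \o W').
    by move=> x; apply: continuous_comp; [exact: cW'|exact: cW].
  apply: (eq_on_total (f := W \o W') (g := idfun) tk cWW') => [y|p] /=.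
    exact: cvg_id.
  by rewrite W'b Wa.
exists W; split=> // [t x|x|].
- apply: (rkhs_inj hF) => s; apply: hdot_injl => v; rewrite VE !evW /a /=.
  by rewrite -(U_iso t x) -(groupD gU) opprD addrC addrNK.
- apply: (rkhs_inj hF) => s; apply: hdot_injl => v; rewrite thE !evW -/th rp_theta_sym.
  by rewrite /a /= theta_translate.
have [cP cD] : closed_subspace (rp_pos X) /\ closed_subspace (rp_pos D).
  by split; split; [exact: rp_pos_subspace|exact: rp_pos_closed
                   |exact: rp_pos_subspace|exact: rp_pos_closed].
apply/seteqP; split=> [_ [x Px <-]|f Df].
  suff : M `<=` W @^-1` rp_pos D by apply; rewrite -(pos_closed_span ta).
  apply: closed_span_min (closed_subspace_preimage cW cD) _ => _ [t [v [t0 ->]]].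
  rewrite /preimage /= -[t]opprK -[U _ _]/(a (- t, v)) Wa posE.
  exact: (pos_space_k hF kE).
exists (W' f); last exact: WK.
suff : pos_space C ev `<=` W' @^-1` rp_pos X by apply; rewrite -posE.
apply: (pos_space_min hF kE (closed_subspace_preimage cW' cP)) => t v t0.
rewrite /preimage /= -[k _ _]/(b (- t, v)) W'b /a /= opprK.
by apply: group_pos (ltW t0) _; case: (j_fixed v).
Qed.

End Uniqueness.

Theorem proposition4p1 (R : realType) (H : hilbertType R)
    (C : R -> {linear H -> H})
    (hC : selfadjoint_contraction_semigroup C) :
  let phi : R -> {linear H -> H} := fun t => C `|t| in
  [/\ (exists (X : rpHilbert R) (U : R -> {linear X -> X})
              (Y : hilbertType R) (q : X -> Y),
         [/\ euclidean_realization C U q,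
             unitary_on_fixed q &
             cyclic_for U (rp_fixed X)]),
      pos_def_kernel (fun s t => phi (s - t)),
      (exists (D : rpHilbert R) (V : R -> {linear D -> D})
              (ev : R -> {linear D -> H}),
         rp_unitary_group V /\ dilation phi V ev) &
      forall (X : rpHilbert R) (U : R -> {linear X -> X})
             (Y : hilbertType R) (q : X -> Y),
        euclidean_realization C U q ->
        unitary_on_fixed q ->
        cyclic_for U (rp_fixed X) ->
        forall (D : rpHilbert R) (V : R -> {linear D -> D})
               (ev : R -> {linear D -> H}),
          dilation phi V ev -> realization_equiv U V].
Proof.
move=> phi; have [D [V [ev [uV dV]]]] := dilation_exists hC; split.
- by exists D, V, H, (ev 0); exact: (dilation_realization hC uV dV).
- exact: semigroup_pos_def.
- by exists D, V, ev.
move=> X U Y q [hU hq [S hS [W0 [uW0 W0S]]]] q_fixed cU D' V' ev' dV'.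
have /choice[j jP] : forall v, exists x, rp_fixed X x /\ W0 (q x) = v.
  move=> v; case: uW0 => _ [g _ gK]; have [_ [_ _ q_surj]] := q_fixed.
  by have [x xf qx] := q_surj (g v) I; exists x; rewrite qx gK.
have j_fixed v : rp_fixed X (j v) by case: (jP v).
have jE v : W0 (q (j v)) = v by case: (jP v).
exact: (realization_unique hC hU hq hS uW0 W0S q_fixed j_fixed jE cU dV').
Qed.
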